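(* Let $n\geq 1$ and let $T$ be a complete first-order theory. The following are equivalent: (1) $T$ is $n$-dependent; (2) every $G_{n+1,p}$-indiscernible (in a monster model of $T$) is actually $L_{\mathrm{op}}$-indiscernible, where $L_{\mathrm{op}}=\{<,P_0,\ldots,P_n\}$; (3) every $G_{n+1}$-indiscernible (in a monster model of $T$) is actually order indiscernible, i.e. $\{<\}$-indiscernible.
   Context: $T$ is a complete theory in a language $L$, $\mathbb{M}$ a monster model. A formula $\varphi(x;y_0,\ldots,y_{n-1})$ (variables may be finite tuples) has $\mathrm{IP}_n$ if in some model of $T$ there is a sequence $(a_{0,i},\ldots,a_{n-1,i})_{i\in\omega}$ such that for every $s\subseteq\omega^n$ there is $b_s$ with $\models\varphi(b_s;a_{0,i_0},\ldots,a_{n-1,i_{n-1}})\Leftrightarrow(i_0,\ldots,i_{n-1})\in s$; otherwise $\varphi$ is $n$-dependent. $T$ is $n$-dependent if every formula is $n$-dependent. Index structures, for $k\ge 1$. An ordered $k$-uniform hypergraph is a structure $(A,<,R)$ with $<$ a linear order and $R$ a $k$-ary relation which is symmetric and holds only of tuples of distinct elements. $G_k$ is the countable ordered $k$-uniform random hypergraph, i.e. the Fraïssé limit of the class of finite ordered $k$-uniform hypergraphs. An ordered $k$-partite $k$-uniform hypergraph is a structure $(A,<,R,P_0,\ldots,P_{k-1})$ such that $A$ is the disjoint union of $P_0,\ldots,P_{k-1}$, $<$ is a linear order with $P_0<\cdots<P_{k-1}$, and $R$ is a symmetric $k$-ary relation such that $R(a_0,\ldots,a_{k-1})$ implies that $\{a_0,\ldots,a_{k-1}\}$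 meets each $P_i$ in exactly one element. $G_{k,p}$ is the countable ordered $k$-partite $k$-uniform random hypergraph, i.e. the Fraïssé limit of the class of finite such structures (parts may be empty). For an $L_0$-structure $I$, a family $(a_i)_{i\in I}$ from $\mathbb{M}$ (each $a_i$ being an element or a finite tuple, of length depending only on the quantifier-free type of $i$) is $I$-indiscernible (also called $L_0$-indiscernible) if for all finite tuples $\bar i,\bar j$ from $I$ of the same length, $\mathrm{qftp}_{L_0}(\bar i)=\mathrm{qftp}_{L_0}(\bar j)$ implies $\mathrm{tp}_L(a_{\bar i})=\mathrm{tp}_L(a_{\bar j})$. For $L_1\subseteq L_0$, $(a_i)_{i\in I}$ is $L_1$-indiscernible if it is $(I|L_1)$-indiscernible, where $I|L_1$ is the reduct. *)

(* Defs.v *)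
From mathcomp Require Import all_boot perm.
From mathcomp Require Import boolp classical_sets functions cardinality.

Set Implicit Arguments.
Unset Strict Implicit.
Unset Printing Implicit Defensive.

Local Open Scope classical_set_scope.
Local Open Scope card_scope.

Record language := Language {
  fun_sym : Type;
  rel_sym : Type;
  fun_arity : fun_sym -> nat;
  rel_arity : rel_sym -> nat
}.

(* The carrier may be empty: this is needed for index structures. Models of a
   theory are required to be nonempty, see [is_model]. *)
Record structure (L : language) := Structure {
  carrier :> Type;
  fun_interp : forall f : fun_sym L, ('I_(fun_arity f) -> carrier) -> carrier;
  rel_interp : forall r : rel_sym L, ('I_(rel_arity r) -> carrier) -> Prop
}.

Inductive term (L : language) (V : Type) : Type :=
| Var of V
| App (f : fun_sym L) of ('I_(fun_arity f) -> term L V).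

(* [formula L V] is the type of first-order formulas whose free variables are
   among the elements of [V]; in [FAll phi] the bound variable is the element
   [None] of [option V]. Negation is [FImp phi FFalse]; the other connectives
   and the existential quantifier are definable classically. *)
Inductive formula (L : language) (V : Type) : Type :=
| FFalse
| FEq of term L V & term L V
| FRel (r : rel_sym L) of ('I_(rel_arity r) -> term L V)
| FImp of formula L V & formula L V
| FAll of formula L (option V).

Arguments FFalse {L V}.

Definition FNot (L : language) (V : Type) (phi : formula L V) : formula L V :=
  FImp phi FFalse.

Definition sentence (L : language) : Type := formula L void.

Fixpoint eval (L : language) (M : structure L) (V : Type) (v : V -> M)
    (t : term L V) : M :=
  match t with
  | Var x => v x
  | App f ts => fun_interp (fun i => eval v (ts i))
  end.

Fixpoint sat (L : language) (M : structure L) (V : Type) (v : V -> M)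
    (phi : formula L V) {struct phi} : Prop :=
  match phi with
  | FFalse => False
  | FEq t1 t2 => eval v t1 = eval v t2
  | FRel r ts => rel_interp (fun i => eval v (ts i))
  | FImp phi1 phi2 => sat v phi1 -> sat v phi2
  | FAll phi1 => forall x : M, sat (oapp v x) phi1
  end.

Fixpoint quantifier_free (L : language) (V : Type) (phi : formula L V) : Prop :=
  match phi with
  | FFalse => True
  | FEq _ _ => True
  | FRel _ _ => True
  | FImp phi1 phi2 => quantifier_free phi1 /\ quantifier_free phi2
  | FAll _ => False
  end.

Definition is_model (L : language) (T : set (sentence L)) (M : structure L) :
    Prop :=
  inhabited M /\ forall s, T s -> sat (of_void M) s.

Definition entails (L : language) (T : set (sentence L)) (s : sentence L) :
    Prop :=
  forall M : structure L, is_model T M -> sat (of_void M) s.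

Definition complete_theory (L : language) (T : set (sentence L)) : Prop :=
  (exists M : structure L, is_model T M) /\
  forall s : sentence L, entails T s \/ entails T (FNot s).

Definition embedding (L : language) (M N : structure L) (f : M -> N) : Prop :=
  [/\ injective f,
      forall (g : fun_sym L) (x : 'I_(fun_arity g) -> M),
        f (fun_interp x) = fun_interp (f \o x) &
      forall (r : rel_sym L) (x : 'I_(rel_arity r) -> M),
        rel_interp x <-> rel_interp (f \o x)].

Definition automorphism (L : language) (M : structure L) (f : M -> M) : Prop :=
  bijective f /\ embedding f.

Definition sublanguage (L : language) (F : set (fun_sym L))
    (R : set (rel_sym L)) : language :=
  Language (fun f : F => fun_arity (val f)) (fun r : R => rel_arity (val r)).

Definition reduct (L : language) (F : set (fun_sym L)) (R : set (rel_sym L))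
    (I : structure L) : structure (sublanguage F R) :=
  @Structure (sublanguage F R) I
    (fun f => @fun_interp L I (val f)) (fun r => @rel_interp L I (val r)).

Definition card_lt (T U : Type) (A : set T) (B : set U) : Prop :=
  ~ (B #<= A).

(* An element of [formula L (option A)] is an L-formula in the single variable
   [None] with parameters [Some a], [a] in [A]. *)
Definition saturated (kappa : Type) (L : language) (M : structure L) : Prop :=
  forall A : set M, card_lt A [set: kappa] ->
  forall p : set (formula L (option A)),
    (forall q : set (formula L (option A)), finite_set q -> q `<=` p ->
       exists c : M, forall phi, q phi -> sat (oapp val c) phi) ->
    exists c : M, forall phi, p phi -> sat (oapp val c) phi.

Definition strongly_homogeneous (kappa : Type) (L : language)
    (M : structure L) : Prop :=
  forall A : set M, card_lt A [set: kappa] ->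
  forall f : A -> M,
    (forall phi : formula L A, sat (val : A -> M) phi <-> sat f phi) ->
    exists2 s : M -> M, automorphism s & forall a : A, s (val a) = f a.

(* The usual convention: kappa-saturated and strongly kappa-homogeneous for
   some kappa > |L|, where |L| is the (infinite) number of L-formulas. *)
Definition monster (L : language) (T : set (sentence L)) (M : structure L) :
    Prop :=
  is_model T M /\
  exists kappa : Type,
    [/\ card_lt [set: formula L nat] [set: kappa],
        saturated kappa M & strongly_homogeneous kappa M].

(* phi(x; y_0, ..., y_{n-1}) with [x] a [p]-tuple of variables and [y_j] a
   [q j]-tuple of variables. *)
Definition has_IP (L : language) (T : set (sentence L)) (n p : nat)
    (q : 'I_n -> nat) (phi : formula L ('I_p + {j : 'I_n & 'I_(q j)})) : Prop :=
  exists M : structure L, is_model T M /\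
  exists a : forall j : 'I_n, nat -> 'I_(q j) -> M,
  forall s : set ('I_n -> nat), exists b : 'I_p -> M,
  forall i : 'I_n -> nat,
    sat (fun z => match z with
                  | inl k => b k
                  | inr w => a (tag w) (i (tag w)) (tagged w)
                  end) phi
    <-> s i.

Definition n_dependent (L : language) (T : set (sentence L)) (n : nat) : Prop :=
  forall (p : nat) (q : 'I_n -> nat)
    (phi : formula L ('I_p + {j : 'I_n & 'I_(q j)})), ~ has_IP T phi.

(* Types of finite tuples of any length; the length of the tuple is recorded,
   so equality of types entails equality of lengths. *)
Definition tp (L : language) (M : structure L) (s : seq M) :
    {m : nat & set (formula L 'I_m)} :=
  Tagged (fun m => set (formula L 'I_m))
    [set phi : formula L 'I_(size s) | sat (tnth (in_tuple s)) phi].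

Definition qftp (L : language) (M : structure L) (s : seq M) :
    {m : nat & set (formula L 'I_m)} :=
  Tagged (fun m => set (formula L 'I_m))
    [set phi : formula L 'I_(size s) |
      quantifier_free phi /\ sat (tnth (in_tuple s)) phi].

Definition indiscernible (L0 L : language) (I : structure L0) (M : structure L)
    (a : I -> seq M) : Prop :=
  (forall i j : I, qftp [:: i] = qftp [:: j] -> size (a i) = size (a j)) /\
  forall u v : seq I, size u = size v -> qftp u = qftp v ->
    tp (flatten (map a u)) = tp (flatten (map a v)).

Definition sub_indiscernible (L0 L : language) (F : set (fun_sym L0))
    (R : set (rel_sym L0)) (I : structure L0) (M : structure L)
    (a : I -> seq M) : Prop :=
  @indiscernible _ _ (reduct F R I) M a.

(* Only meant for relational languages, where finitely generated structures
   are the finite ones. *)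
Definition fraisse_limit (L : language) (K : structure L -> Prop)
    (G : structure L) : Prop :=
  [/\ countable [set: G],
      forall A : structure L,
        K A <-> finite_set [set: A] /\ exists f : A -> G, embedding f &
      forall (A : structure L) (f g : A -> G), finite_set [set: A] ->
        embedding f -> embedding g ->
        exists2 s : G -> G, automorphism s & s \o f = g].

Definition strict_linear_order (A : Type) (lt : A -> A -> Prop) : Prop :=
  [/\ forall x, ~ lt x x,
      forall x y z, lt x y -> lt y z -> lt x z &
      forall x y, [\/ lt x y, x = y | lt y x]].

Definition symmetric_rel (A : Type) (k : nat) (R : ('I_k -> A) -> Prop) :
    Prop :=
  forall (x : 'I_k -> A) (s : {perm 'I_k}), R x -> R (x \o s).

Inductive hypergraph_sym := HLt | HEdge.

Definition L_hypergraph (k : nat) : language :=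
  @Language void hypergraph_sym (of_void nat)
    (fun r => match r with HLt => 2 | HEdge => k end).

Definition hlt (k : nat) (A : structure (L_hypergraph k)) (x y : A) : Prop :=
  @rel_interp _ A HLt (tnth [tuple x; y]).

Definition hedge (k : nat) (A : structure (L_hypergraph k)) (x : 'I_k -> A) :
    Prop :=
  @rel_interp _ A HEdge x.

Definition ordered_hypergraph (k : nat) (A : structure (L_hypergraph k)) :
    Prop :=
  [/\ strict_linear_order (@hlt k A),
      symmetric_rel (@hedge k A) &
      forall x : 'I_k -> A, hedge x -> injective x].

Definition is_random_hypergraph (k : nat) (G : structure (L_hypergraph k)) :
    Prop :=
  fraisse_limit
    (fun A => finite_set [set: A] /\ ordered_hypergraph A) G.

Inductive partite_sym (k : nat) := PLt | PEdge | PPart of 'I_k.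

Arguments PLt {k}.
Arguments PEdge {k}.

Definition L_partite (k : nat) : language :=
  @Language void (partite_sym k) (of_void nat)
    (fun r => match r with PLt => 2 | PEdge => k | PPart _ => 1 end).

Definition plt (k : nat) (A : structure (L_partite k)) (x y : A) : Prop :=
  @rel_interp _ A PLt (tnth [tuple x; y]).

Definition pedge (k : nat) (A : structure (L_partite k)) (x : 'I_k -> A) :
    Prop :=
  @rel_interp _ A PEdge x.

Definition part (k : nat) (A : structure (L_partite k)) (i : 'I_k) (x : A) :
    Prop :=
  @rel_interp _ A (PPart i) (tnth [tuple x]).

Definition ordered_partite_hypergraph (k : nat) (A : structure (L_partite k)) :
    Prop :=
  [/\ forall x : A, exists! i : 'I_k, part i x,
      strict_linear_order (@plt k A),
      forall (i j : 'I_k) (x y : A), i < j -> part i x -> part j y -> plt x y,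
      symmetric_rel (@pedge k A) &
      forall x : 'I_k -> A, pedge x ->
        forall i : 'I_k, exists! y : A, (exists j, x j = y) /\ part i y].

Definition is_random_partite_hypergraph (k : nat)
    (G : structure (L_partite k)) : Prop :=
  fraisse_limit
    (fun A => finite_set [set: A] /\ ordered_partite_hypergraph A) G.

Definition order_indiscernible (L : language) (M : structure L) (k : nat)
    (G : structure (L_hypergraph k)) (a : G -> seq M) : Prop :=
  @sub_indiscernible (L_hypergraph k) L set0 [set HLt] G M a.

Definition op_indiscernible (L : language) (M : structure L) (k : nat)
    (G : structure (L_partite k)) (a : G -> seq M) : Prop :=
  @sub_indiscernible (L_partite k) L set0
    ([set PLt] `|` range (@PPart k)) G M a.

(* Main.v *)
Require Import Defs.
From mathcomp Require Import all_boot fingroup perm zify.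
From Stdlib Require List.
From mathcomp Require Import boolp classical_sets functions cardinality.

(** Both index structures are viewed as ordered hypergraphs with coloured
    vertices: there is one colour in the first case, and the colour is the
    number of the part in the second. The proof uses only that they are
    countable and that their finite substructures are, up to isomorphism, the
    finite hypergraphs of the relevant kind.

    _From n-dependence to collapse_ ([same_cut_same_type]). If an indiscernible
    does not collapse, there are two tuples with the same order and colours, and
    with different types. Changing the edges one at a time leads to such tuples
    [u] and [w] that differ in a single edge [e]; say that [e] is an edge for
    [u], and that [phi] holds of [u] and fails of [w]. Replace every vertex of
    [u] by [N] copies and put an arbitrary [n+1]-partite hypergraph [D] on the
    copies of the vertices of [e]. The result is a hypergraph of the same kind,
    so it can be found in the index structure, and there [phi] decides which
    choices of copies belong to [D] ([flip_edge]). Since [N] and [D] are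
    arbitrary, saturation yields a formula with IP_n ([finite_IP]): the copies
    of one vertex of [e] provide the [b_s], the other vertices of [e] the
    sequences, and the rest of [u] becomes a tuple of parameters.

    _From collapse to n-dependence_ ([collapse_n_dependent]). If [phi] has IP_n,
    every relation of arity [n+1] on a countable set is defined by [phi] on some
    family indexed by this set. For the edge relation of a countable ordered
    hypergraph the family can be made indiscernible with respect to order and
    edges ([indiscernible_edge_family]). It does not collapse, because [phi]
    separates an edge from a non-edge with the same order and colours. The
    parts of a partite hypergraph may be forgotten here: naming them only makes
    indiscernibility weaker.

    By compactness, making the family indiscernible comes down to the Ramsey
    property of finite ordered hypergraphs ([hypergraph_Ramsey]), which is
    deduced from the Graham-Rothschild theorem as follows. Call atoms of a
    [k]-uniform hypergraph the sets of fewer than [k] vertices and the edges, so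
    that [k] vertices form an edge if and only if they lie in a common atom. A
    parameter word having one parameter for each nonempty atom turns a vertex
    into a set of positions, those that carry an atom containing the vertex, and
    [k] vertices form an edge if and only if their sets have a common point.
    Intersecting the atoms with a subset of the vertices gives the atoms of the
    induced hypergraph. So, if every parameter is replaced by the intersection
    of its atom with the subset, the result is a parameter word for the induced
    hypergraph which gives the same vertices. Two isomorphic subsets lead to two
    words with the same parameters, and the Graham-Rothschild theorem gives them
    the same colour. *)

Set Implicit Arguments.
Unset Strict Implicit.
Unset Printing Implicit Defensive.

(** * The Hales-Jewett theorem *)

(** In a combinatorial line [None] stands for the variable. *)
Definition plug (x : nat) (p : seq (option nat)) : seq nat := map (odflt x) p.

Definition line (t : nat) (p : seq (option nat)) : bool :=
  all (oapp (fun y => y < t) true) p && (None \in p).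

Lemma plug_some x w : plug x (map some w) = w.
Proof. by rewrite /plug -map_comp map_id. Qed.

Lemma plug_cat x p q : plug x (p ++ q) = plug x p ++ plug x q.
Proof. exact: map_cat. Qed.

Lemma plug_all t x p : all (oapp (fun y => y < t) true) p -> x < t ->
  all (fun y => y < t) (plug x p).
Proof.
move=> hp xt; rewrite /plug all_map; apply: sub_all hp => -[y|] //=.
Qed.

Definition HJ_stmt t := forall K : finType, exists N, forall chi : seq nat -> K,
  exists p, [/\ size p = N, line t p &
    forall x y, x < t -> y < t -> chi (plug x p) = chi (plug y p)].

Lemma word_tuple t N (w : seq nat) : size w = N -> all (fun y => y < t.+1) w ->
  exists u : N.-tuple 'I_t.+1, map val u = w.
Proof.
move=> sw aw.
have su : size (map (@inord t) w) == N by rewrite size_map sw.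
exists (Tuple su) => /=; rewrite -map_comp map_id_in // => x /(allP aw) h /=.
by rewrite inordK.
Qed.

(** Colour focusing: failing a monochromatic line, one finds [s] lines through a
    common last point [w] that are monochromatic below it, in [s] colours none
    of which is the colour of [w]; there is no room for more than [#|K|]. *)
Lemma HJ_focus t (K : finType) s : HJ_stmt t.+1 ->
  exists N, forall chi : seq nat -> K,
    (exists p, [/\ size p = N, line t.+2 p &
      forall x y, x < t.+2 -> y < t.+2 -> chi (plug x p) = chi (plug y p)]) \/
    (exists w (C : {set K}), [/\ size w = N, all (fun y => y < t.+2) w,
       #|C| = s, chi w \notin C &
       forall c, c \in C -> exists p, [/\ size p = N, line t.+2 p,
         plug t.+1 p = w & forall x, x < t.+1 -> chi (plug x p) = c]]).
Proof.
move=> hj; elim: s => [|s [N1 IH]].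
  exists 0 => chi; right; exists [::], finset.set0; split=> //; rewrite ?cards0 ?inE //.
  by move=> c; rewrite inE.
(* A line [q] on which the colour of every extended word [w ++ _] is constant
   below the last letter [t.+1]. *)
have [N2 hN2] := hj {ffun N1.-tuple 'I_t.+2 -> K}.
exists (N1 + N2) => chi.
have [q [sq /andP[aq nq] hq]] := hN2 (fun v => [ffun w : N1.-tuple 'I_t.+2 =>
  chi (map val w ++ v)]).
have {}hq w x y : size w = N1 -> all (fun y => y < t.+2) w ->
    x < t.+1 -> y < t.+1 -> chi (w ++ plug x q) = chi (w ++ plug y q).
  move=> sw aw hx hy; have [u uE] := word_tuple sw aw.
  by have /ffunP/(_ u) := hq x y hx hy; rewrite !ffunE uE.
have aq' : all (oapp (fun y => y < t.+2) true) q.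
  by apply: sub_all aq => -[y|] //= hy; rewrite (leq_trans hy).
have [[p [sp /andP[ap np] hp]]|[w [C [sw aw cC wC hC]]]] :=
    IH (fun w => chi (w ++ plug 0 q)).
  left; exists (p ++ map some (plug 0 q)); split.
  - by rewrite size_cat !size_map sp sq.
  - rewrite /line all_cat ap mem_cat np /= andbT all_map.
    exact: plug_all.
  - by move=> x y hx hy; rewrite !plug_cat !plug_some; apply: hp.
have q_lt x : x < t.+1 -> chi (w ++ plug x q) = chi (w ++ plug 0 q).
  by move=> hx; apply: hq.
pose w' := w ++ plug t.+1 q.
have line_cat c p : [/\ size p = N1, line t.+2 p, plug t.+1 p = w &
    forall x, x < t.+1 -> chi (plug x p ++ plug 0 q) = c] ->
  [/\ size (p ++ q) = N1 + N2, line t.+2 (p ++ q), plug t.+1 (p ++ q) = w' &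
    forall x, x < t.+1 -> chi (plug x (p ++ q)) = c].
  move=> [sp /andP[ap np] pw hp]; split.
  - by rewrite size_cat sp sq.
  - by rewrite /line all_cat ap aq' mem_cat np.
  - by rewrite plug_cat pw.
  - move=> x hx; rewrite plug_cat -(hp x hx); apply: hq => //.
      by rewrite size_map.
    by apply: plug_all => //; rewrite (leq_trans hx).
have line_w : [/\ size (map some w ++ q) = N1 + N2, line t.+2 (map some w ++ q),
    plug t.+1 (map some w ++ q) = w' &
    forall x, x < t.+1 -> chi (plug x (map some w ++ q)) = chi (w ++ plug 0 q)].
  split; first by rewrite size_cat size_map sw sq.
  - by rewrite /line all_cat aq' mem_cat nq orbT /= !andbT all_map.
  - by rewrite plug_cat plug_some.
  - by move=> x hx; rewrite plug_cat plug_some q_lt.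
have mono c p : [/\ size p = N1 + N2, line t.+2 p, plug t.+1 p = w' &
    forall x, x < t.+1 -> chi (plug x p) = c] -> chi w' = c ->
  forall x y, x < t.+2 -> y < t.+2 -> chi (plug x p) = chi (plug y p).
  move=> [_ _ pw hp] hc.
  have h x : x < t.+2 -> chi (plug x p) = c.
    by rewrite ltnS leq_eqVlt => /orP[/eqP->|/hp//]; rewrite pw.
  by move=> x y /h-> /h->.
have [w'C|w'C] := boolP (chi w' \in C).
  have [p /line_cat hp] := hC _ w'C.
  by left; exists (p ++ q); split; [case: hp|case: hp|apply: mono hp _].
have [w'w|w'w] := eqVneq (chi w') (chi (w ++ plug 0 q)).
  left; exists (map some w ++ q); split; [by case: line_w|by case: line_w|].
  exact: mono line_w w'w.
right; exists w', (chi (w ++ plug 0 q) |: C); split.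
- by rewrite size_cat size_map sw sq.
- by rewrite all_cat aw; apply: plug_all.
- by rewrite cardsU1 wC cC.
- by rewrite in_setU1 negb_or w'w.
- move=> c; rewrite in_setU1 => /orP[/eqP->|/hC[p /line_cat hp]].
    by exists (map some w ++ q).
  by exists (p ++ q).
Qed.

Lemma Hales_Jewett t : HJ_stmt t.+1.
Proof.
elim: t => [|t IH] K.
  exists 1 => chi; exists [:: None]; split=> // x y.
  by rewrite !ltnS !leqn0 => /eqP-> /eqP->.
have [N hN] := HJ_focus K #|K| IH; exists N => chi.
have [//|[w [C [_ _ cC]]]] := hN chi.
suff -> : C = [set: K]%SET by rewrite inE.
by apply/eqP; rewrite eqEcard finset.subsetT cardsT cC leqnn.
Qed.

(** * The Graham-Rothschild theorem *)

(** Words with parameters: the letters are the numbers below [t], the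
    parameters are [t, ..., t + d - 1], and they make their first appearances
    in this order. Once it has appeared, a parameter is treated as a letter of
    a larger alphabet. *)
Fixpoint pword (t d : nat) (w : seq nat) : bool :=
  match w with
  | [::] => d == 0
  | x :: w' => (x < t) && pword t d w' || [&& x == t, 0 < d & pword t.+1 d.-1 w']
  end.

Definition letters t := all (fun y => y < t).

(** The parameters of [f] are replaced by the entries of [g]; the segment
    [iota 0 t] keeps the letters in place. *)
Definition sub t (f g : seq nat) : seq nat := map (nth 0 (iota 0 t ++ g)) f.

Lemma letters_leq t t' w : t <= t' -> letters t w -> letters t' w.
Proof. by move=> tt'; apply: sub_all => x; move/leq_trans; apply. Qed.

Lemma pword0 t w : pword t 0 w = letters t w.
Proof. by elim: w => //= x w ->; rewrite !andbF orbF. Qed.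

Lemma pword_letters t d w : pword t d w -> letters (t + d) w.
Proof.
elim: w t d => //= x w IH t d /orP[/andP[xt /IH->]|/and3P[/eqP-> d0 /IH]].
  by rewrite (leq_trans xt) // leq_addr.
by rewrite addSnnS prednK // => ->; rewrite -addn1 leq_add.
Qed.

Lemma pword_prefix t d u v : letters t u -> pword t d (u ++ v) = pword t d v.
Proof.
elim: u => //= x u IH /andP[xt /IH->].
by rewrite xt /= (ltn_eqF xt) /= orbF.
Qed.

Lemma pword_first t d v : pword t d.+1 (t :: v) = pword t.+1 d v.
Proof. by rewrite /= ltnn eqxx. Qed.

Lemma pword_split t d w : pword t d.+1 w -> exists u v,
  [/\ w = u ++ t :: v, letters t u & pword t.+1 d v].
Proof.
elim: w => //= x w IH /orP[/andP[xt /IH[u [v [-> hu hv]]]]|].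
  by exists (x :: u), v; rewrite /= xt.
by move=> /andP[/eqP-> hv]; exists [::], w.
Qed.

Lemma pword_mem t d w y : pword t d w -> t <= y < t + d -> y \in w.
Proof.
elim: w t d => [|x w IH] t d /=; first by move=> /eqP->; lia.
move=> /orP[/andP[xt /IH h]|/and3P[/eqP-> d0 h]] hy; rewrite inE.
  by rewrite h ?orbT.
have [//|yt] := eqVneq y t; apply: (IH t.+1 d.-1) => //; lia.
Qed.

(** Recognises a parameter word position by position, which suits words whose
    letters are given by a formula. *)
Lemma pword_growth t d w :
  letters (t + d) w ->
  (forall y, t <= y < t + d -> y \in w) ->
  (forall i z, i < size w -> z < nth 0 w i -> t <= z -> z \in take i w) ->
  pword t d w.
Proof.
elim: w t d => [|x w IH] t d /=.
  by case: d => // d _ hy _; have : t \in [::] by apply: hy; lia.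
move=> /andP[xtd hl] hy hg.
have xt : x <= t.
  rewrite leqNgt; apply/negP => tx.
  by have := hg 0 t isT tx (leqnn _).
have [{}xt|tx] := ltnP x t.
  rewrite IH // => [y hyt|i z iw zw tz].
    by have := hy y hyt; rewrite inE => /orP[/eqP|//]; lia.
  by have := hg i.+1 z iw zw tz; rewrite inE => /orP[/eqP|//]; lia.
have {xt tx} xE : x = t by lia.
rewrite xE eqxx /=; apply/andP; split; first lia.
apply: IH => [|y hyt|i z iw zw tz].
- apply: letters_leq hl; lia.
- by have : y \in x :: w by [apply: hy; lia]; rewrite inE => /orP[/eqP|//]; lia.
- have : z \in x :: take i w by apply: (hg i.+1) => //; lia.
  by rewrite inE => /orP[/eqP|//]; lia.
Qed.

Lemma size_sub t f g : size (sub t f g) = size f.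
Proof. exact: size_map. Qed.

Lemma sub_cat t f1 f2 g : sub t (f1 ++ f2) g = sub t f1 g ++ sub t f2 g.
Proof. exact: map_cat. Qed.

Lemma sub_first t f g : sub t (t :: f) (t :: g) = t :: sub t.+1 f g.
Proof.
have -> : sub t.+1 f g = map (nth 0 (iota 0 t ++ t :: g)) f.
  by rewrite /sub -[t.+1]addn1 iotaD -catA.
by rewrite /sub map_cons nth_cat size_iota ltnn subnn.
Qed.

Lemma nth_iota_cat t g y : y < t -> nth 0 (iota 0 t ++ g) y = y.
Proof. by move=> yt; rewrite nth_cat size_iota yt nth_iota. Qed.

Lemma sub_assoc t f g h : letters (t + size g) f ->
  sub t (sub t f g) h = sub t f (sub t g h).
Proof.
move=> hf; rewrite /sub -map_comp; apply/eq_in_map => y /(allP hf) yt /=.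
have [ty|ty] := ltnP y t; first by rewrite !nth_iota_cat // nth_iota_cat.
rewrite (nth_cat 0 (iota 0 t) g) (nth_cat 0 (iota 0 t) (map _ g)) size_iota.
rewrite ltnNge ty /= (nth_map 0) //; lia.
Qed.

(** Induction on [f], where [e] collects the letters and the values of those
    parameters that have already been read. *)
Lemma pword_sub_env t m t' d f e g : size e = t -> letters t' e ->
  pword t m f -> size g = m -> pword t' d g ->
  pword t' d (map (nth 0 (e ++ g)) f).
Proof.
elim: f t m t' d e g => [|x f IH] t m t' d e g se he /=.
  by move=> /eqP-> /size0nil->.
move=> /orP[/andP[xt hf] sg hg|/and3P[/eqP-> m0 hf]].
  rewrite nth_cat se xt (allP he) ?mem_nth ?se //=.
  by rewrite (IH t m).
case: g m0 => [|y g] /=; first by move=> + E; rewrite -E.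
move=> m0 sg /orP[/andP[yt hg]|/and3P[/eqP-> d0 hg]].
  rewrite nth_cat se ltnn subnn /= yt /=.
  rewrite -cat_rcons (IH t.+1 m.-1) ?size_rcons ?se //; first by rewrite /letters all_rcons yt.
  by rewrite -sg.
rewrite nth_cat se ltnn subnn /= ltnn eqxx d0 /=.
rewrite -cat_rcons (IH t.+1 m.-1) ?size_rcons ?se // -?sg //.
by rewrite /letters all_rcons ltnSn; apply: letters_leq he.
Qed.

Lemma pword_sub t m d f g : pword t m f -> size g = m -> pword t d g ->
  pword t d (sub t f g).
Proof.
move=> hf sg hg; apply: pword_sub_env hf sg hg; first exact: size_iota.
by apply/allP => y; rewrite mem_iota.
Qed.

(** Makes room for a new letter [t]. *)
Definition up t := map (fun y => if y < t then y else y.+1).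

Lemma pword_up_ge t0 t m w : t0 <= t -> pword t m w -> pword t.+1 m (up t0 w).
Proof.
elim: w t m => //= x w IH t m t0t /orP[/andP[xt /(IH _ _ t0t)->]|].
  by rewrite andbT; case: ifP => _; rewrite ?ltnS ?xt // ltnW.
move=> /and3P[/eqP-> m0 hw]; have -> : (t < t0) = false by lia.
rewrite ltnn eqxx m0 /=; by apply: IH => //; apply: leqW.
Qed.

Lemma pword_up t m w : pword t m w -> pword t.+1 m (up t w).
Proof. exact: pword_up_ge. Qed.

Lemma sub_up t f x v : sub t (up t f) (x :: v) = sub t f v.
Proof.
rewrite /sub /up -map_comp; apply: eq_map => y /=.
rewrite !nth_cat !size_iota; case: (ltnP y t) => [-> //|ty].
by rewrite ltnNge (leqW ty) /= subSn.
Qed.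

Lemma sub_plug t p x v : all (oapp (fun y => y < t) true) p ->
  sub t (plug t p) (x :: v) = plug x p.
Proof.
move=> hp; rewrite /sub /plug -map_comp; apply/eq_in_map => -[y|] /(allP hp) /=.
  exact: nth_iota_cat.
by rewrite nth_cat size_iota ltnn subnn.
Qed.

(** Hales-Jewett, applied from left to right, once for each parameter. [E u] is
    the part of a substitution instance that is determined by the first
    [size u] values: all that precedes the first occurrence of the next
    parameter. *)
Lemma prefix_colouring t M : forall K : finType, exists N,
  forall chi : seq nat -> K, exists f (E : seq nat -> seq nat),
  [/\ size f = N, pword t.+1 M f,
      forall u v, letters t.+1 u -> size u + size v = M ->
        exists r, sub t.+1 f (u ++ v) = E u ++ r /\
          (forall z v', v = z :: v' -> exists r', r = z :: r') /\
          (v = [::] -> r = [::]),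
      forall u, letters t.+1 u -> letters t.+1 (E u) &
      forall u u', letters t.+1 u -> letters t.+1 u' -> size u = size u' ->
        size u <= M -> chi (E u) = chi (E u')].
Proof.
elim: M => [|M IH] K.
  exists 0 => chi; exists [::], (fun=> [::]); split=> // u v hu.
  case: u hu => // _; case: v => // _; by exists [::]; split.
have [N1 h1] := IH K.
pose K2 : finType := {ffun {w : 'I_N1.+1 & w.-tuple 'I_t.+1} -> K}.
(* A word is coloured by the function that gives the colour of its extensions
   by at most [N1] letters. *)
have [N2 h2] := @Hales_Jewett t K2.
exists (N2 + N1) => chi.
have [p [sp /andP[ap np] hp]] := h2 (fun v =>
  [ffun w : {w : 'I_N1.+1 & w.-tuple 'I_t.+1} => chi (v ++ map val (tagged w))]).
have {}hp x y w : x < t.+1 -> y < t.+1 -> letters t.+1 w -> size w <= N1 ->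
    chi (plug x p ++ w) = chi (plug y p ++ w).
  move=> hx hy hw sw; have [w' wE] := word_tuple erefl hw.
  have /ffunP := hp x y hx hy.
  pose i : 'I_N1.+1 := @Ordinal N1.+1 (size w) sw.
  move=> /(_ (Tagged (fun w : 'I_N1.+1 => w.-tuple 'I_t.+1) (w' : i.-tuple _))).
  by rewrite !ffunE /= wE.
have [f [E [sf pf hE lE cE]]] := h1 (fun v => chi (plug 0 p ++ v)).
have [p0 [p1 [pE np0]]] : exists p0 p1, p = map some p0 ++ None :: p1 /\ letters t.+1 p0.
  elim: p ap np {sp hp cE} => //= -[y|] p IHp /=.
    move=> /andP[yt ap]; rewrite inE /= => /(IHp ap)[p0 [p1 [-> l0]]].
    by exists (y :: p0), p1; rewrite /= yt.
  by move=> _ _; exists [::], p.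
have plugE x : plug x p = p0 ++ x :: plug x p1.
  by rewrite pE plug_cat plug_some.
pose E' u := if u is x :: u' then plug x p ++ E u' else p0.
have sE x v : sub t.+1 (plug t.+1 p ++ up t.+1 f) (x :: v) =
    plug x p ++ sub t.+1 f v.
  by rewrite sub_cat sub_plug // sub_up.
exists (plug t.+1 p ++ up t.+1 f), E'; split.
- by rewrite size_cat !size_map sp sf.
- rewrite plugE -catA pword_prefix //= ltnn eqxx /=.
  rewrite pword_prefix; first exact: pword_up.
  apply: plug_all => //; move: ap; rewrite pE all_cat /= => /andP[_].
  by apply: sub_all => -[y|] //= hy; rewrite (leq_trans hy).
- move=> [|x u] v.
    move=> _; case: v => // x v [sv]; rewrite cat0s sE plugE -catA.
    exists (x :: plug x p1 ++ sub t.+1 f v); split=> //; split=> // z v' [<- _].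
    by eexists.
  move=> /andP[xt hu] [suv]; rewrite cat_cons sE.
  have [r [-> hr]] := hE u v hu suv.
  by exists r; rewrite /= -catA.
- move=> [_|x u /andP[xt hu]] //=.
  rewrite /letters all_cat; apply/andP; split; last exact: lE.
  exact: plug_all.
- move=> [|x u] [|x' u'] //= /andP[xt hu] /andP[xt' hu'] [suu'] suM.
  have lenE w : letters t.+1 w -> size w <= M -> size (E w) <= N1.
    move=> hw sw.
    have [|r [rE _]] := hE w (nseq (M - size w) 0) hw.
      by rewrite size_nseq subnKC.
    by rewrite -sf -(size_sub t.+1 f (w ++ nseq (M - size w) 0)) rE size_cat leq_addr.
  rewrite (hp x 0) ?lE ?lenE // (hp x' 0) ?lE ?lenE // -?suu' //; exact: cE.
Qed.

Definition GR_stmt t d := forall (K : finType) m, exists N,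
  forall chi : seq nat -> K, exists f, [/\ size f = N, pword t m f &
    forall g g', size g = m -> size g' = m -> pword t d g -> pword t d g' ->
      chi (sub t f g) = chi (sub t f g')].

(** Making the colour depend only on the letters [w] that precede the first
    parameter. What follows the first parameter is a word over an alphabet that
    has this parameter as a letter, with one parameter less. So the theorem for
    [d] takes care of the empty [w], and the words with a given first letter [x]
    are dealt with by induction, simultaneously for all [x]. *)
Lemma GR_prefix t d m : GR_stmt t.+1 d -> forall K : finType, exists N,
  forall chi : seq nat -> K, exists f, [/\ size f = N, pword t m f &
    forall w g g', letters t w -> size w + (size g).+1 = m ->
      size w + (size g').+1 = m -> pword t.+1 d g -> pword t.+1 d g' ->
      chi (sub t f (w ++ t :: g)) = chi (sub t f (w ++ t :: g'))].
Proof.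
move=> gr; elim: m => [|m IH] K.
  by exists 0 => chi; exists [::]; split=> // w g g' _; lia.
have [N2 h2] := IH {ffun 'I_t -> K}.
have [N1 h1] := gr K N2.
exists N1.+1 => chi.
have [f1 [sf1 pf1 cf1]] := h1 (fun v => chi (t :: v)).
have [f2 [sf2 pf2 cf2]] :=
  h2 (fun v => [ffun x : 'I_t => chi (sub t (t :: f1) (val x :: v))]).
have ps2 := pword_up pf2.
have ss2 : size (up t f2) = N2 by rewrite size_map.
have lf1 : letters (t.+1 + size (up t f2)) f1.
  by rewrite ss2; apply: pword_letters.
exists (t :: sub t.+1 f1 (up t f2)); split.
- by rewrite /= size_sub sf1.
- by rewrite pword_first; apply: pword_sub pf1 ss2 _.
move=> [|x w] g g' hw sg sg' hg hg'.
  rewrite !cat0s !sub_first !sub_assoc //.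
  have sz h : size (sub t.+1 (up t f2) h) = N2 by rewrite size_sub.
  by apply: cf1 => //; apply: pword_sub ps2 _ _ => //; move: sg sg' => /=; lia.
have {hw} /andP[xt hw] := hw.
have E v : sub t (t :: sub t.+1 f1 (up t f2)) (x :: v) =
    sub t (t :: f1) (x :: sub t f2 v).
  have Ex : sub t (t :: up t f2) (x :: v) = x :: sub t f2 v.
    rewrite -(sub_up t f2 x v) /sub map_cons; congr (_ :: _).
    by rewrite nth_cat size_iota ltnn subnn.
  rewrite -sub_first sub_assoc ?Ex //= /letters /= addnS ltnS leq_addr /=.
  by apply: letters_leq lf1; lia.
move: sg sg'; rewrite !cat_cons !E /= => sg sg'.
have /ffunP/(_ (Ordinal xt)) := cf2 w g g' hw ltac:(lia) ltac:(lia) hg hg'.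
by rewrite !ffunE.
Qed.

(** Substituting into this word moves first occurrences of parameters to
    positions selected by [b]. *)
Fixpoint place (y m : nat) (b : bitseq) : seq nat :=
  match b with
  | [::] => [::]
  | x :: b' => if x && (0 < m) then y :: place y.+1 m.-1 b' else 0 :: place y m b'
  end.

Lemma size_place y m b : size (place y m b) = size b.
Proof. by elim: b y m => //= x b IH y m; case: ifP; rewrite /= IH. Qed.

Lemma pword_place t m b : 0 < t -> m <= count id b -> pword t m (place t m b).
Proof.
elim: b t m => [|x b IH] t m t0 /=; first by rewrite leqn0.
case: x => /=; last by move=> mb; rewrite t0 IH.
case: m => [_|m mb] /=; first by rewrite t0 IH.
by rewrite ltnn eqxx IH.
Qed.

(** [e] collects the letters and the values of those parameters that have
    already been read; it is nonempty because the filler [0] has to be a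
    letter. *)
Lemma sub_place t0 b : forall e m u g, letters t0 e -> e != [::] ->
  letters t0 u -> size u + (size g).+1 = m -> m <= count id b ->
  exists u' r, [/\ map (nth 0 (e ++ u ++ t0 :: g)) (place (size e) m b) =
      u' ++ t0 :: r, letters t0 u' & nth false b (size u')].
Proof.
elim: b => [|x b IH] e m u g he e0 hu sm /=; first by lia.
have h0 : nth 0 (e ++ u ++ t0 :: g) 0 < t0.
  by case: e e0 he => //= y e _ /andP[].
have m0 : 0 < m by lia.
case: x => /= mb; last first.
  have [u' [r [-> hu' hb]]] := IH e m u g he e0 hu sm mb.
  by exists (nth 0 (e ++ u ++ t0 :: g) 0 :: u'), r; rewrite /= h0.
rewrite m0; case: u hu sm {h0} => [|x u] hu sm.
  exists [::]; eexists; rewrite cat0s map_cons nth_cat ltnn subnn /=.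
  by split.
have {hu} /andP[xt hu] := hu.
have [|||||u' [r [E hu' hb]]] := IH (rcons e x) m.-1 u g.
- by rewrite /letters all_rcons xt.
- by case: (e).
- by [].
- by move: sm => /=; lia.
- by lia.
exists (x :: u'), r; rewrite map_cons nth_cat ltnn subnn /= xt; split=> //.
by move: E; rewrite size_rcons cat_rcons => ->.
Qed.

Lemma pigeonhole_fun (K : finType) (x0 : K) m (k : nat -> K) : exists c,
  m <= count (fun j => k j == c) (iota 0 (m * #|K|)).
Proof.
have K0 : 0 < #|K| by apply/card_gt0P; exists x0.
case: (pickP (fun c => m <= count (fun j => k j == c) (iota 0 (m * #|K|)))).
  by move=> c hc; exists c.
move=> h; have : \sum_(c : K) count (fun j => k j == c) (iota 0 (m * #|K|)) =
  m * #|K|.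
  under eq_bigr do rewrite -sum1_count big_mkcond /=.
  rewrite exchange_big /= (eq_bigr (fun=> 1)) => [|j _].
    by rewrite sum1_size size_iota.
  by rewrite -big_mkcond /= (eq_bigl (pred1 (k j))) ?big_pred1_eq // => c;
     rewrite /= eq_sym.
case: m h => [|m] h; first by exists x0.
have : \sum_(c : K) count (fun j => k j == c) (iota 0 (m.+1 * #|K|)) <=
    \sum_(c : K) m.
  by apply: leq_sum => c _; have := h c; rewrite leqNgt => /negbFE; rewrite ltnS.
by move=> + E; rewrite E sum_nat_const mulnC leq_pmul2l // ltnn.
Qed.

(** Induction on the number of parameters. For [d.+1] of them, the colour is
    made to depend only on the word before the first parameter ([f]), then only
    on the length of this word ([f1]), and finally all lengths but those of one
    colour are avoided ([f2]). *)
Theorem Graham_Rothschild d t : GR_stmt t.+1 d.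
Proof.
elim: d t => [|d IH] t K m.
  have [N hN] := prefix_colouring t m K; exists N => chi.
  have [f [E [sf pf hE _ cE]]] := hN chi; exists f; split=> // g g' sg sg'.
  rewrite !pword0 => hg hg'.
  have EE u : letters t.+1 u -> size u = m -> sub t.+1 f u = E u.
    move=> hu su; have [|r [+ [_ /(_ erefl) r0]]] := hE u [::] hu; first by rewrite addn0.
    by rewrite r0 !cats0.
  by rewrite !EE //; apply: cE => //; rewrite ?sg ?sg'.
have [m0|m0] := posnP m.
  by exists 0 => chi; exists [::]; rewrite m0; split=> // g g' /size0nil->.
pose M := m * #|K|.
have [N1 h1] := prefix_colouring t M K.
have [N h] := GR_prefix N1 (IH t.+1) K.
exists N => chi.
have [f [sf pf cf]] := h chi.
have /choice[chi' hchi'] : forall w, exists c, forall g, letters t.+1 w ->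
    size w + (size g).+1 = N1 -> pword t.+2 d g ->
    chi (sub t.+1 f (w ++ t.+1 :: g)) = c.
  move=> w; have [[g0 [hw s0 p0]]|no] := pselect (exists g, [/\ letters t.+1 w,
    size w + (size g).+1 = N1 & pword t.+2 d g]).
    by exists (chi (sub t.+1 f (w ++ t.+1 :: g0))) => g _ sg pg; apply: cf.
  by exists (chi [::]) => g h1' h2' h3'; case: no; exists g.
have [f1 [E [sf1 pf1 hE lE cE]]] := h1 chi'.
have [c hc] := pigeonhole_fun (chi [::]) m (fun j => chi' (E (nseq j 0))).
pose b := map (fun j => chi' (E (nseq j 0)) == c) (iota 0 M).
have sb : size b = M by rewrite size_map size_iota.
have cb : m <= count id b by rewrite count_map.
pose f2 := place t.+1 m b.
have sf2 : size f2 = M by rewrite size_place.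
have pf2 : pword t.+1 m f2 by apply: pword_place.
exists (sub t.+1 f (sub t.+1 f1 f2)); split; first by rewrite size_sub.
  apply: (pword_sub pf); first by rewrite size_sub.
  exact: pword_sub pf1 sf2 pf2.
have key g : size g = m -> pword t.+1 d.+1 g ->
    chi (sub t.+1 (sub t.+1 f (sub t.+1 f1 f2)) g) = c.
  move=> sg pg.
  rewrite sub_assoc; last by rewrite size_sub sf1; apply: pword_letters.
  rewrite sub_assoc; last by rewrite sf2; apply: pword_letters.
  have [u [v [gE hu hv]]] := pword_split pg.
  have := pword_sub pf2 sg pg.
  have [|||||u' [r [E2 hu' hb]]] := @sub_place t.+1 b (iota 0 t.+1) m u v.
  - by apply/allP => y; rewrite mem_iota.
  - by [].
  - by [].
  - by rewrite -sg gE size_cat.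
  - by [].
  have {}E2 : sub t.+1 f2 g = u' ++ t.+1 :: r by rewrite -E2 size_iota gE.
  rewrite E2.
  rewrite pword_prefix // pword_first => pr.
  have ub : size u' < M.
    by rewrite -sb ltnNge; apply/negP => /(nth_default false); rewrite hb.
  have sur : size u' + (size r).+1 = M.
    by have := congr1 size E2; rewrite size_sub sf2 size_cat.
  have [r' [E3 [/(_ _ _ erefl)[r'' r'E] _]]] := hE u' (t.+1 :: r) hu' sur.
  rewrite E3 r'E (hchi' (E u') r'') ?lE //; last 2 first.
  - by rewrite -sf1 -(size_sub t.+1 f1 (u' ++ t.+1 :: r)) E3 r'E size_cat.
  - have : pword t.+1 d.+1 (sub t.+1 f1 (u' ++ t.+1 :: r)).
      by apply: pword_sub pf1 _ _; rewrite ?size_cat // pword_prefix ?pword_first.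
    by rewrite E3 r'E pword_prefix ?lE // pword_first.
  move: hb; rewrite (nth_map 0) ?size_iota // nth_iota // add0n => /eqP <-.
  apply: cE => //; first by apply/allP => y /nseqP[->].
    by rewrite size_nseq.
  exact: ltnW.
by move=> g g' sg sg' pg pg'; rewrite !key.
Qed.

(** Finitely many two-colourings, of words with possibly different numbers of
    parameters, can be treated one after the other. *)
Lemma GR_simultaneous (ds : seq nat) m : exists N,
  forall chi : nat -> seq nat -> Prop, exists f,
  [/\ size f = N, pword 1 m f & forall i, i < size ds -> forall g g',
    size g = m -> size g' = m -> pword 1 (nth 0 ds i) g ->
    pword 1 (nth 0 ds i) g' -> chi i (sub 1 f g) <-> chi i (sub 1 f g')].
Proof.
elim: ds m => [|d ds IH] m.
  exists m => chi; exists (iota 1 m); rewrite size_iota; split=> //.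
  elim: m 1 => //= m IHm t; by rewrite ltnn eqxx IHm.
have [N' h'] := IH m.
have [N h] := @Graham_Rothschild d 0 bool N'.
exists N => chi.
have [f1 [sf1 pf1 cf1]] := h (fun w => `[<chi 0 w>]).
have [f2 [sf2 pf2 cf2]] := h' (fun i w => chi i.+1 (sub 1 f1 w)).
have lf1 : letters (1 + size f2) f1 by rewrite sf2; apply: pword_letters.
exists (sub 1 f1 f2); split; first by rewrite size_sub.
  exact: pword_sub pf1 sf2 pf2.
case=> [_|i hi] g g' sg sg' pg pg'; rewrite !sub_assoc //; last exact: (cf2 i).
have := cf1 (sub 1 f2 g) (sub 1 f2 g'); rewrite !size_sub.
move=> /(_ sf2 sf2 (pword_sub pf2 sg pg) (pword_sub pf2 sg' pg')) E.
exact: (asbool_eq_equiv E).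
Qed.

(** * The Ramsey property of ordered hypergraphs *)

Section Colex.
Variables (B : finType) (rk : B -> nat).
Hypothesis rk_inj : injective rk.

(** The binary number with digits [S], so that comparing weights is comparing
    sets colexicographically. *)
Definition weight (S : {set B}) := \sum_(x in S) 2 ^ rk x.

Lemma weight_subset (S S' : {set B}) : S \subset S' -> weight S <= weight S'.
Proof.
move=> /finset.setIidPr SS'; rewrite /weight (big_setID S (A := S')) /= SS'.
exact: leq_addr.
Qed.

Lemma weight_below (S : {set B}) n : \sum_(x in S | rk x < n) 2 ^ rk x < 2 ^ n.
Proof.
elim: n => [|n IH]; first by rewrite big_pred0 // => x; rewrite ltn0 andbF.
rewrite (bigID (fun x => rk x < n)) /= expnS mul2n -addnn -addSn.
apply: leq_add.
  apply: leq_trans IH; rewrite ltnS; apply: eq_leq; apply: eq_bigl => x.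
  by case: (x \in S) => //=; lia.
have [x0 hx0|no] := pickP (fun x => (x \in S) && (rk x < n.+1) && ~~ (rk x < n)).
  rewrite (bigD1 x0) //= big_pred0 ?addn0.
    by rewrite leq_exp2l //; move: hx0 => /andP[/andP[]]; rewrite ltnS.
  move=> x; apply/negP => /andP[/andP[/andP[_ h1] h2] /eqP[]].
  by apply: rk_inj; move: hx0 => /andP[/andP[_ h3] h4]; lia.
by rewrite big_pred0.
Qed.

Definition colex (S S' : {set B}) :=
  exists x, [/\ x \in S', x \notin S &
    forall y, rk x < rk y -> (y \in S) = (y \in S')].

Lemma colex_weight S S' : colex S S' -> weight S < weight S'.
Proof.
move=> [x [xS' xS h]].
rewrite /weight (bigID (fun y => rk y < rk x)) /=.
rewrite [X in _ < X](bigID (fun y => rk y < rk x)) /=.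
rewrite (bigD1 x (P := fun y => (y \in S') && ~~ _)) /=; last by rewrite xS' ltnn.
have -> : \sum_(i in S | ~~ (rk i < rk x)) 2 ^ rk i =
   \sum_(i in B | (i \in S') && ~~ (rk i < rk x) && (i != x)) 2 ^ rk i.
  apply: eq_bigl => y /=; have [->|yx] := eqVneq y x.
    by rewrite (negbTE xS) andbF.
  have [xy|] := ltnP (rk x) (rk y); first by rewrite h // !andbT.
  rewrite leq_eqVlt => /orP[/eqP/rk_inj E|->]; last by rewrite !andbF.
  by rewrite E eqxx in yx.
rewrite addnA ltn_add2r; apply: leq_trans (weight_below S (rk x)) _.
exact: leq_addl.
Qed.

Lemma colex_total S S' : S <> S' -> colex S S' \/ colex S' S.
Proof.
move=> SS'.
have [x0 hx0] : exists x, (x \in S) != (x \in S').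
  apply/existsP; apply: contra_notT SS' => /existsPn h.
  by apply/finset.setP => x; have := h x; rewrite negbK => /eqP.
case: (@arg_maxnP _ x0 (fun x => (x \in S) != (x \in S')) rk hx0) => x hx hmax.
have h y : rk x < rk y -> (y \in S) = (y \in S').
  move=> xy; apply/eqP; apply: contraTT xy => /hmax.
  by rewrite -leqNgt.
move: hx; case xS: (x \in S); case xS': (x \in S') => // _.
  by right; exists x; rewrite xS xS'; split=> // y /h.
by left; exists x; rewrite xS xS'.
Qed.

Lemma weight_inj : injective weight.
Proof.
move=> S S' E; apply: contrapT => /colex_total[] /colex_weight;
by rewrite E ltnn.
Qed.

Lemma weight_ltP S S' : weight S < weight S' <-> colex S S'.
Proof.
split; last exact: colex_weight.
move=> h; have [E|/colex_total[//|/colex_weight]] := pselect (S = S').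
  by rewrite E ltnn in h.
by move=> h'; lia.
Qed.

End Colex.

Lemma eqn_of_ltn a b c d : (a < b) = (c < d) -> (b < a) = (d < c) ->
  (a == b) = (c == d).
Proof. by case: (ltngtP a b); case: (ltngtP c d). Qed.

(** The colexicographic order is decided by the greatest element of the symmetric
    difference, so strictly increasing maps preserve it. *)
Lemma weight_imset (B B' : finType) (rk : B -> nat) (rk' : B' -> nat) (l : finType)
    (u : l -> B) (v : l -> B') : injective rk -> injective rk' ->
  (forall a b, (rk (u a) < rk (u b)) = (rk' (v a) < rk' (v b))) ->
  forall Y Y' : {set l}, (weight rk (u @: Y) <= weight rk (u @: Y')) =
                         (weight rk' (v @: Y) <= weight rk' (v @: Y')).
Proof.
move=> ri ri' uv Y Y'; rewrite !(leqNgt (weight _ _)); congr (~~ _).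
have eq_uv a b : (u a == u b) = (v a == v b).
  by rewrite -(inj_eq ri) -(inj_eq ri'); apply: eqn_of_ltn; apply: uv.
have mem_uv a (Z : {set l}) : (u a \in u @: Z) = (v a \in v @: Z).
  apply/imsetP/imsetP => -[b bZ /eqP E]; exists b => //; apply/eqP.
    by rewrite -eq_uv.
  by rewrite eq_uv.
suff half (C C' : finType) (rc : C -> nat) (rc' : C' -> nat) (f : l -> C)
    (g : l -> C') : injective rc -> injective rc' ->
    (forall a b, (rc (f a) < rc (f b)) = (rc' (g a) < rc' (g b))) ->
    (forall a (Z : {set l}), (f a \in f @: Z) = (g a \in g @: Z)) ->
    weight rc (f @: Y') < weight rc (f @: Y) ->
    weight rc' (g @: Y') < weight rc' (g @: Y).
  apply/idP/idP; first exact: half.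
  by apply: half => // *; rewrite ?uv ?mem_uv.
move=> rci rci' fg mem_fg /(weight_ltP rci)[x [/imsetP[a aY ->] xS h]].
apply/(weight_ltP rci'); exists (g a); split; first exact: imset_f.
  by rewrite -mem_fg.
move=> y ay; have mem_y b : y = g b -> (y \in g @: Y') = (y \in g @: Y).
  by move=> E; move: ay; rewrite E -!mem_fg -fg => /h.
apply/idP/idP => hy; have /imsetP[b _ yb] := hy.
  by rewrite -(mem_y b yb).
by rewrite (mem_y b yb).
Qed.

Lemma index_sorted_ltn (T : eqType) (f : T -> nat) (s : seq T) x y :
  sorted (fun a b => f a <= f b) s -> x \in s -> y \in s -> f x < f y ->
  index x s < index y s.
Proof.
move=> ss xs ys; rewrite !ltnNge; apply: contra => h.
have tr : transitive (fun a b => f a <= f b) by move=> a b c; apply: leq_trans.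
by apply: (sorted_leq_index tr _ ss) => // a; apply: leqnn.
Qed.

Section HypergraphRamsey.
Variables (B : finType) (rk : B -> nat) (k : nat) (ED : {set {set B}}).
Hypothesis rk_inj : injective rk.
Hypothesis k0 : 0 < k.
Hypothesis ED_card : forall S, S \in ED -> #|S| = k.

(** These sets are closed under passing to subsets, and contain a set of [k]
    elements only if it is an edge. *)
Definition is_atom (S : {set B}) := (#|S| < k) || (S \in ED).

Definition atoms : seq {set B} :=
  sort (fun S S' => weight rk S <= weight rk S') (enum is_atom).

Lemma mem_atoms S : (S \in atoms) = is_atom S.
Proof. by rewrite mem_sort mem_enum. Qed.

Lemma is_atom0 : is_atom finset.set0.
Proof. by rewrite /is_atom cards0 k0. Qed.

Lemma is_atom_sub (S S' : {set B}) : S' \subset S -> is_atom S -> is_atom S'.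
Proof.
move=> S'S hS; have [->//|ne] := eqVneq S' S.
have S'ltS : #|S'| < #|S|.
  by apply: proper_card; rewrite finset.properEneq ne.
rewrite /is_atom (leq_trans S'ltS) //.
by case/orP: hS => [/ltnW//|/ED_card->].
Qed.

Lemma weight_tot (A : finType) (f : A -> nat) :
  total (fun a b : A => f a <= f b).
Proof. by move=> a b; apply: leq_total. Qed.

Section Trace.
Variables (l : nat) (u : 'I_l -> B).

(** The traces are the intersections of atoms with the range of [u], pulled back
    to the domain of [u]; as a map with repetitions is allowed, they are the
    unions of fibres. *)
Definition is_trace (Y : {set 'I_l}) :=
  (u @^-1: (u @: Y) == Y) && is_atom (u @: Y).

Definition traces : seq {set 'I_l} :=
  sort (fun Y Y' : {set 'I_l} => weight rk (u @: Y) <= weight rk (u @: Y')) (enum is_trace).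

(** The empty atom comes first in the enumeration. It stands for the constant
    letter [0], and is not a parameter. *)
Definition trace_word : seq nat :=
  map (fun y => index (u @^-1: nth finset.set0 atoms y) traces)
    (iota 1 (size atoms).-1).

Lemma mem_traces Y : (Y \in traces) = is_trace Y.
Proof. by rewrite mem_sort mem_enum. Qed.

Lemma imset_preim_sub (S : {set B}) : u @: (u @^-1: S) \subset S.
Proof. by apply/fintype.subsetP => x /imsetP[a]; rewrite inE => + ->. Qed.

Lemma preim_imset_preim (S : {set B}) :
  u @^-1: (u @: (u @^-1: S)) = u @^-1: S.
Proof.
apply/finset.setP => a; rewrite !inE; apply/idP/idP; last first.
  by move=> h; apply: imset_f; rewrite inE.
exact: (fintype.subsetP (imset_preim_sub S)).
Qed.

Lemma trace_preim (S : {set B}) : is_atom S -> is_trace (u @^-1: S).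
Proof.
by move=> hS; rewrite /is_trace preim_imset_preim eqxx (is_atom_sub _ hS) ?imset_preim_sub.
Qed.

Lemma weight0_head (A : finType) (f : A -> {set B}) (s : seq A) (x0 : A) :
  f x0 = finset.set0 -> {in s &, injective f} -> x0 \in s ->
  sorted (fun a b => weight rk (f a) <= weight rk (f b)) s -> index x0 s = 0.
Proof.
case: s => // y s fx0 finj xs ss /=; case: eqP => // yx.
have h : weight rk (f x0) < weight rk (f y).
  rewrite ltn_neqAle fx0 weight_subset ?finset.sub0set // andbT.
  apply/eqP => /(weight_inj rk_inj) E; case: yx.
  by apply: finj; rewrite ?fx0 ?mem_head.
have := index_sorted_ltn (f := fun a => weight rk (f a)) ss xs (mem_head _ _) h.
by rewrite [X in _ < X]/= eqxx.
Qed.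

Lemma atoms_sorted : sorted (fun S S' => weight rk S <= weight rk S') atoms.
Proof. apply: sort_sorted; exact: weight_tot. Qed.

Lemma traces_sorted :
  sorted (fun Y Y' : {set 'I_l} => weight rk (u @: Y) <= weight rk (u @: Y')) traces.
Proof. apply: sort_sorted => Y Y'; exact: leq_total. Qed.

Lemma index_atoms0 : index finset.set0 atoms = 0.
Proof.
apply: (weight0_head (f := id)) => //.
  by rewrite mem_atoms is_atom0.
exact: atoms_sorted.
Qed.

Lemma trace0 : finset.set0 \in traces.
Proof. by rewrite mem_traces /is_trace imset0 is_atom0 finset.preimset0 eqxx. Qed.

Lemma index_traces0 : index finset.set0 traces = 0.
Proof.
apply: (weight0_head (f := fun Y : {set 'I_l} => u @: Y)) => //.
- exact: imset0.
- move=> Y Y'; rewrite !mem_traces => /andP[/eqP hY _] /andP[/eqP hY' _] E.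
  by rewrite -hY -hY' E.
- exact: trace0.
- exact: traces_sorted.
Qed.

Lemma size_atoms : 0 < size atoms.
Proof. by rewrite -index_atoms0 index_mem mem_atoms is_atom0. Qed.

Lemma size_traces : 0 < size traces.
Proof. by rewrite -index_traces0 index_mem trace0. Qed.

Lemma nth_atoms0 : nth finset.set0 atoms 0 = finset.set0.
Proof. by rewrite -[X in nth _ _ X]index_atoms0 nth_index // mem_atoms is_atom0. Qed.

Lemma nth_trace_word y : y < size atoms ->
  nth 0 (iota 0 1 ++ trace_word) y =
  index (u @^-1: nth finset.set0 atoms y) traces.
Proof.
case: y => [_|y yA] /=.
  by rewrite nth_atoms0 finset.preimset0 index_traces0.
have yA' : y < (size atoms).-1 by have := size_atoms; lia.
by rewrite (nth_map 0) ?size_iota // nth_iota.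
Qed.

Lemma size_trace_word : size trace_word = (size atoms).-1.
Proof. by rewrite size_map size_iota. Qed.

Lemma trace_atom Y : Y \in traces -> u @: Y \in atoms.
Proof. by rewrite mem_traces mem_atoms => /andP[]. Qed.

Lemma nth_atom y : y < size atoms -> is_atom (nth finset.set0 atoms y).
Proof. by move=> h; rewrite -mem_atoms mem_nth. Qed.

(** Among the atoms with trace [Y] the image of [Y] comes first, as it is
    contained in the others. The traces are listed in the order of their images,
    so they make their first appearances in this order. *)
Lemma pword_trace_word : pword 1 (size traces).-1 trace_word.
Proof.
have sT := size_traces; have sA := size_atoms.
have addE : 1 + (size traces).-1 = size traces by lia.
apply: pword_growth; rewrite ?addE.
- apply/allP => _ /mapP[y + ->]; rewrite mem_iota => hy.
  by rewrite index_mem mem_traces trace_preim // nth_atom //; lia.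
- move=> z /andP[z0 zT].
  pose Y := nth finset.set0 traces z.
  have YT : Y \in traces by apply: mem_nth.
  have YA := trace_atom YT.
  have /andP[/eqP hY _] : is_trace Y by rewrite -mem_traces.
  have iY : index Y traces = z by rewrite index_uniq // sort_uniq enum_uniq.
  apply/mapP; exists (index (u @: Y) atoms); last first.
    by rewrite nth_index // hY iY.
  have iA : index (u @: Y) atoms < size atoms by rewrite index_mem.
  rewrite mem_iota add1n prednK // iA andbT lt0n; apply/eqP => i0.
  have E : u @: Y = finset.set0 by rewrite -nth_atoms0 -i0 nth_index.
  by move: z0; rewrite -iY -hY E finset.preimset0 index_traces0.
- rewrite size_trace_word => i z iA.
  have iA' : i.+1 < size atoms by lia.
  have -> : nth 0 trace_word i = nth 0 (iota 0 1 ++ trace_word) i.+1 by [].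
  rewrite nth_trace_word //; set S := nth _ atoms _ => zi z0.
  have SA : is_atom S by apply: nth_atom.
  pose Y := nth finset.set0 traces z.
  have tS : u @^-1: S \in traces by rewrite mem_traces trace_preim.
  have zT : z < size traces by apply: ltn_trans zi _; rewrite index_mem.
  have YT : Y \in traces by apply: mem_nth.
  have YA := trace_atom YT.
  have /andP[/eqP hY _] : is_trace Y by rewrite -mem_traces.
  have iY : index Y traces = z by rewrite index_uniq // sort_uniq enum_uniq.
  have wlt : weight rk (u @: Y) < weight rk S.
    apply: (@leq_trans (weight rk (u @: (u @^-1: S)))); last first.
      exact/weight_subset/imset_preim_sub.
    rewrite ltn_neqAle; apply/andP; split.
      apply/eqP => /(weight_inj rk_inj) E.
      by move: zi; rewrite -iY -hY E preim_imset_preim ltnn.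
    have := @sorted_leq_index _ _ _ _ _ traces_sorted Y (u @^-1: S) YT tS.
    apply.
    - by move=> a b c; apply: leq_trans.
    - by move=> a; apply: leqnn.
    - by rewrite iY ltnW.
  have ilt : index (u @: Y) atoms < i.+1.
    have -> : i.+1 = index S atoms.
      by rewrite index_uniq // sort_uniq enum_uniq.
    apply: (index_sorted_ltn (f := weight rk)) => //; first exact: atoms_sorted.
    by rewrite mem_atoms.
  have i0 : 0 < index (u @: Y) atoms.
    rewrite lt0n; apply/eqP => i0.
    have E : u @: Y = finset.set0 by rewrite -nth_atoms0 -i0 nth_index.
    by move: z0; rewrite -iY -hY E finset.preimset0 index_traces0.
  rewrite /trace_word -map_take; apply/mapP.
  exists (index (u @: Y) atoms); last by rewrite nth_index // hY iY.
  rewrite take_iota mem_iota i0 /= add1n ltnS leq_min -ltnS ilt /=.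
  by apply: leq_trans (ltnW iA); rewrite -ltnS.
Qed.

End Trace.

(** The set of positions of [f] that carry an atom containing [x]. *)
Definition vertex (f : seq nat) (x : B) : bitseq :=
  map (fun y => x \in nth finset.set0 atoms y) f.

(** Whether an atom contains [u a] can be read off its trace. So the restriction
    to the range of [u] of the copy given by [f] is the copy given by a word in
    the traces. *)
Lemma vertex_trace (l : nat) (u : 'I_l -> B) f a :
  letters (size atoms) f ->
  vertex f (u a) = map (fun z => a \in nth finset.set0 (traces u) z)
                     (sub 1 f (trace_word u)).
Proof.
move=> hf; rewrite /vertex /sub -map_comp; apply/eq_in_map => y /(allP hf) yA /=.
by rewrite nth_trace_word // nth_index ?inE // mem_traces trace_preim // nth_atom.
Qed.

Lemma traces_eq (l : nat) (u v : 'I_l -> B) :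
  (forall a b, (rk (u a) < rk (u b)) = (rk (v a) < rk (v b))) ->
  (forall Y : {set 'I_l}, (u @: Y \in ED) = (v @: Y \in ED)) ->
  traces u = traces v.
Proof.
move=> uv eD.
have eq_uv a b : (u a == u b) = (v a == v b).
  by rewrite -!(inj_eq rk_inj); apply: eqn_of_ltn; apply: uv.
have mem_uv a (Z : {set 'I_l}) : (u a \in u @: Z) = (v a \in v @: Z).
  apply/imsetP/imsetP => -[b bZ /eqP E]; exists b => //; apply/eqP.
    by rewrite -eq_uv.
  by rewrite eq_uv.
have card_uv Z : #|u @: Z| = #|v @: Z|.
  have h (f g : 'I_l -> B) : (forall a b, (f a == f b) = (g a == g b)) ->
      #|f @: Z| <= #|g @: Z|.
    move=> fg; pose h x := if [pick a in Z | g a == x] is Some a then f a else x.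
    apply: leq_trans (leq_imset_card h (g @: Z)); apply: subset_leq_card.
    apply/fintype.subsetP => _ /imsetP[a aZ ->]; apply/imsetP; exists (g a).
      by apply/imsetP; exists a.
    rewrite /h; case: pickP => [b /andP[_ /eqP E]|/(_ a)]; last by rewrite aZ eqxx.
    by apply/eqP; rewrite fg E.
  by apply/eqP; rewrite eqn_leq !h.
rewrite /traces.
have -> : enum (is_trace u) = enum (is_trace v).
  apply: eq_enum => Y; rewrite !unfold_in /is_trace /is_atom card_uv eD; congr (_ && _).
  by congr (_ == _); apply/finset.setP => a; rewrite !inE mem_uv.
congr (sort _ _); apply: funext => Y; apply: funext => Y'.
exact: weight_imset.
Qed.

(** Finitely many colourings [chi i], each of which is to be equal on the two
    tuples [u i] and [v i] of the same order and edge pattern. Such tuples have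
    the same traces ([traces_eq]), so the copies of both are instances of the
    same parameters. *)
Theorem hypergraph_Ramsey (r : nat) (l : nat -> nat) (u v : forall i, 'I_(l i) -> B)
    (chi : forall i, ('I_(l i) -> bitseq) -> Prop) :
  (forall i a b, (rk (u i a) < rk (u i b)) = (rk (v i a) < rk (v i b))) ->
  (forall i (Y : {set 'I_(l i)}), (u i @: Y \in ED) = (v i @: Y \in ED)) ->
  exists X : B -> bitseq,
    (forall S : {set B}, k <= #|S| ->
       (exists i, forall x, x \in S -> nth false (X x) i) <-> S \in ED) /\
    (forall i, i < r -> chi i (X \o u i) <-> chi i (X \o v i)).
Proof.
move=> uv eD.
have [N hN] := GR_simultaneous (mkseq (fun i => (size (traces (u i))).-1) r)
  (size atoms).-1.
have [f [sf pf cf]] := hN (fun i w => chi i (fun a =>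
  map (fun z => a \in nth finset.set0 (traces (u i)) z) w)).
have addE : 1 + (size atoms).-1 = size atoms by have := size_atoms; lia.
have lf : letters (size atoms) f by rewrite -addE; apply: pword_letters.
exists (vertex f); split.
  move=> S kS; split.
    move=> [i hi].
    have /card_gt0P[x0 x0S] : 0 < #|S| by apply: leq_trans kS.
    have iN : i < size f.
      rewrite ltnNge -(size_map (fun y => x0 \in nth finset.set0 atoms y) f).
      by apply/negP => /(nth_default false); have := hi _ x0S => ->.
    have yA : nth 0 f i < size atoms by apply: (allP lf); apply: mem_nth.
    have SA : S \subset nth finset.set0 atoms (nth 0 f i).
      by apply/fintype.subsetP => x /hi; rewrite (nth_map 0).
    have := nth_atom yA; rewrite /is_atom.
    set A := nth _ atoms _ in SA *; move/orP=> [hA|hA].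
      by have := subset_leq_card SA; lia.
    suff -> : S = A by [].
    by apply/eqP; rewrite eqEcard SA (ED_card hA).
  move=> hS; have SA : S \in atoms by rewrite mem_atoms /is_atom hS orbT.
  have S0 : 0 < index S atoms.
    rewrite lt0n; apply/eqP => i0; have := ED_card hS.
    by rewrite -(nth_index finset.set0 SA) i0 nth_atoms0 cards0; lia.
  have yf : index S atoms \in f.
    by apply: (pword_mem pf); rewrite S0 addE index_mem.
  exists (index (index S atoms) f) => x xS.
  by rewrite (nth_map 0) ?index_mem // nth_index // nth_index.
move=> i ir.
have tE := traces_eq (uv i) (eD i).
have Eu : vertex f \o u i = fun a => map (fun z => a \in nth finset.set0 (traces (u i)) z)
    (sub 1 f (trace_word (u i))).
  by apply: funext => a /=; rewrite vertex_trace.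
have Ev : vertex f \o v i = fun a => map (fun z => a \in nth finset.set0 (traces (u i)) z)
    (sub 1 f (trace_word (v i))).
  by apply: funext => a /=; rewrite vertex_trace // tE.
rewrite Eu Ev; apply: cf; rewrite ?size_mkseq ?size_trace_word // nth_mkseq //.
  exact: pword_trace_word.
rewrite tE; exact: pword_trace_word.
Qed.

End HypergraphRamsey.

Local Open Scope classical_set_scope.

(** * Formulas and saturation *)

Section Syntax.
Variable L : language.

Fixpoint trename (V W : Type) (f : V -> W) (t : term L V) : term L W :=
  match t with
  | Var x => Var L (f x)
  | App g ts => App (fun i => trename f (ts i))
  end.

Fixpoint rename (V W : Type) (f : V -> W) (phi : formula L V) {struct phi} :
    formula L W :=
  match phi with
  | FFalse => FFalse
  | FEq t1 t2 => FEq (trename f t1) (trename f t2)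
  | FRel r ts => FRel (fun i => trename f (ts i))
  | FImp phi1 phi2 => FImp (rename f phi1) (rename f phi2)
  | FAll phi1 => FAll (rename (omap f) phi1)
  end.

Lemma eval_trename (M : structure L) V W (f : V -> W) (v : W -> M) t :
  eval v (trename f t) = eval (v \o f) t.
Proof.
elim: t => //= g ts IH; congr fun_interp.
by apply: funext => i; rewrite IH.
Qed.

Lemma sat_rename (M : structure L) V W (f : V -> W) (v : W -> M) phi :
  sat v (rename f phi) = sat (v \o f) phi.
Proof.
elim: phi W f v => {V} //= [V t1 t2|V r ts|V p1 IH1 p2 IH2|V p IH] W f v.
- by rewrite !eval_trename.
- by congr rel_interp; apply: funext => i; rewrite eval_trename.
- by rewrite IH1 IH2.
- apply: propext; split=> H x; move: (H x); rewrite IH;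
  by congr sat; apply: funext => -[].
Qed.

Definition FEx V (phi : formula L (option V)) : formula L V :=
  FNot (FAll (FNot phi)).

Lemma sat_FEx (M : structure L) V (v : V -> M) phi :
  sat v (FEx phi) <-> exists x, sat (oapp v x) phi.
Proof.
split=> [/existsNP[x /contrapT]|[x hx] h]; first by exists x.
exact: (h x hx).
Qed.

Definition FAnds V (s : seq (formula L V)) : formula L V :=
  FNot (foldr (fun p q => FImp p q) FFalse s).

Lemma sat_FAnds (M : structure L) V (v : V -> M) s :
  sat v (FAnds s) <-> forall p, List.In p s -> sat v p.
Proof.
rewrite /=; elim: s => [|q s IH] /=; first by split=> // _; apply.
split.
- move=> /not_implyP[h1 /IH h2] p [<-//|]; exact: h2.
- move=> h; apply/not_implyP; split; first by apply: h; left.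
  by apply/IH => p hp; apply: h; right.
Qed.

Lemma eval_support V (t : term L V) (c : V -> nat) :
  exists m, forall (M : structure L) (v v' : V -> M),
    (forall x, c x < m -> v x = v' x) -> eval v t = eval v' t.
Proof.
elim: t => [x|g ts IH] /=; first by exists (c x).+1 => M v v'; apply.
have /choice[m hm] := IH.
exists (\max_i m i) => M v v' h; congr fun_interp; apply: funext => i.
by apply: hm => x hx; apply: h; apply: leq_trans hx _; apply: leq_bigmax.
Qed.

(** A formula mentions finitely many variables; [c] numbers them. *)
Lemma sat_support V (phi : formula L V) (c : V -> nat) :
  exists m, forall (M : structure L) (v v' : V -> M),
    (forall x, c x < m -> v x = v' x) -> sat v phi = sat v' phi.
Proof.
elim: phi c => {V} [V|V t1 t2|V r ts|V p1 IH1 p2 IH2|V p IH] c /=.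
- by exists 0.
- have [m1 h1] := eval_support t1 c; have [m2 h2] := eval_support t2 c.
  exists (maxn m1 m2) => M v v' h; congr (_ = _);
    [apply: h1 | apply: h2] => x hx; apply: h; rewrite leq_max hx ?orbT //.
- have /choice[m hm] : forall i, exists m, forall (M : structure L) v v', _ :=
    fun i => eval_support (ts i) c.
  exists (\max_i m i) => M v v' h; congr rel_interp; apply: funext => i.
  by apply: hm => x hx; apply: h; apply: leq_trans hx _; apply: leq_bigmax.
- have [m1 h1] := IH1 c; have [m2 h2] := IH2 c.
  exists (maxn m1 m2) => M v v' h.
  rewrite (h1 M v v') ?(h2 M v v') // => x hx; apply: h;
  by rewrite leq_max hx ?orbT.
- have [m hm] := IH (oapp c 0); exists m => M v v' h.
  apply: propext; split=> H x; move: (H x); rewrite (hm M _ (oapp v' x)) //;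
  by case=> //= y /h.
Qed.

Lemma ex_sentence_ord m (phi : formula L 'I_m) :
  exists s : sentence L, forall M : structure L,
    sat (of_void M) s <-> exists v : 'I_m -> M, sat v phi.
Proof.
elim: m phi => [|m IH] phi.
  have no : 'I_0 -> void by case.
  exists (rename no phi) => M; rewrite sat_rename.
  split; first by exists (of_void M \o no).
  by move=> [v]; congr sat; apply: funext => -[].
have [s hs] := IH (FEx (rename (fun i => unlift ord0 i) phi)).
exists s => M; apply: (iff_trans (hs M)); split.
- move=> [v /sat_FEx[x]]; rewrite sat_rename => h.
  by exists (oapp v x \o unlift ord0).
- move=> [v h]; exists (v \o lift ord0); apply/sat_FEx; exists (v ord0).
  rewrite sat_rename; move: h; congr sat; apply: funext => i /=.
  by case: unliftP => [j ->|->].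
Qed.

Lemma ex_sentence (phi : formula L nat) :
  exists s : sentence L, forall M : structure L,
    sat (of_void M) s <-> exists v : nat -> M, sat v phi.
Proof.
have [m hm] := sat_support phi id.
have [s hs] := ex_sentence_ord (rename (@inord m) phi).
exists s => M; apply: (iff_trans (hs M)); split.
- by move=> [v]; rewrite sat_rename; exists (v \o inord).
- move=> [v h]; exists (v \o val); rewrite sat_rename.
  by rewrite (hm M _ v) // => x hx /=; rewrite inordK // ltnS ltnW.
Qed.

End Syntax.

Arguments FEx {L V}.
Arguments FAnds {L V}.

Section Transfer.
Variables (L : language) (T : set (sentence L)).
Hypothesis hT : complete_theory T.

Lemma transfer (M' M : structure L) (s : seq (formula L nat)) (v' : nat -> M') :
  is_model T M' -> is_model T M ->
  (forall p, List.In p s -> sat v' p) ->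
  exists v : nat -> M, forall p, List.In p s -> sat v p.
Proof.
move=> hM' hM /sat_FAnds hs.
have [t ht] := ex_sentence (FAnds s).
have h' : sat (of_void M') t by apply/ht; exists v'.
case: hT => _ /(_ t)[/(_ M hM)/ht[v /sat_FAnds hv]|]; first by exists v.
by move/(_ M' hM')/(_ h').
Qed.

End Transfer.

Lemma finite_set_list (X : Type) (A : set X) :
  finite_set A -> exists s : seq X, forall x, A x <-> List.In x s.
Proof.
move=> /(@finite_seqP {classic X})[s ->]; exists s => x /=.
elim: s => [|y s IH] //=; rewrite inE; split.
- by move=> /orP[/eqP->|/IH]; [left|right].
- by move=> [->|/IH->]; rewrite ?eqxx ?orbT.
Qed.

Lemma list_in_image (X Y : Type) (f : X -> Y) (A : set X) (s : seq Y) :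
  (forall y, List.In y s -> (f @` A) y) ->
  exists2 s' : seq X, s = map f s' & forall x, List.In x s' -> A x.
Proof.
elim: s => [|y s IH] hs; first by exists [::].
have [|s' -> h] := IH; first by move=> z hz; apply: hs; right.
have [|x h1 <-] := hs y; first by left.
by exists (x :: s') => // z [<-|/h].
Qed.

Section Realize.
Variables (L : language) (T : set (sentence L)) (M : structure L).
Hypothesis hM : monster T M.

Lemma formula_nat_infinite : exists f : nat -> formula L nat, injective f.
Proof.
exists (fun n => iter n (fun p => FImp p FFalse) FFalse).
by elim=> [|i IH] [|j] //= [] /IH ->.
Qed.


Local Open Scope card_scope.

Lemma saturated_countable (A : set M) : countable A ->
  forall p : set (formula L (option A)),
    (forall s : seq (formula L (option A)), (forall f, List.In f s -> p f) ->
       exists c : M, forall f, List.In f s -> sat (oapp val c) f) ->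
    exists c : M, forall phi, p phi -> sat (oapp val c) phi.
Proof.
move=> cA p hp.
have [_ [kappa [hk hs _]]] := hM.
apply: (hs A).
- move=> hA; apply: hk; apply: card_le_trans hA _.
  apply: card_le_trans cA _.
  have [f injf] := formula_nat_infinite.
  have h : f @` [set: nat] #= [set: nat] by apply: inj_card_eq => x y _ _ /injf.
  by rewrite -(card_le_eql h); apply: card_leT.
- move=> q /finite_set_list[s hq] qp.
  have [c hc] := hp s (fun f hf => qp f (proj2 (hq f) hf)).
  by exists c => phi /hq /hc.
Qed.

(** The parameters of the formulas are supplied by [asg]. Taking finitely many
    members of [Sigma] at a time makes consequences of a finitely satisfiable
    set satisfiable. *)
Definition consequence (V U : Type) (asg : (V -> M) -> U -> M)
    (Sigma : set (formula L U)) (phi : formula L U) : Prop :=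
  exists2 s : seq (formula L U), (forall f, List.In f s -> Sigma f) &
    forall v : V -> M, (forall f, List.In f s -> sat (asg v) f) ->
      sat (asg v) phi.

Lemma consequence_FAnds V U (asg : (V -> M) -> U -> M) Sigma s :
  (forall f, List.In f s -> consequence asg Sigma f) ->
  consequence asg Sigma (FAnds s).
Proof.
elim: s => [|f s IH] h; first by exists [::] => // v _; apply/sat_FAnds.
have [s1 h1 c1] := h f (or_introl erefl).
have [|s2 h2 c2] := IH; first by move=> g hg; apply: h; right.
exists (s1 ++ s2) => [g /List.in_app_iff[/h1|/h2]//|v hv].
apply/sat_FAnds => g [<-|]; first by apply: c1 => p hp; apply/hv/List.in_app_iff; left.
by move: g; apply/sat_FAnds/c2 => p hp; apply/hv/List.in_app_iff; right.
Qed.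

(** Realising a finitely satisfiable set of formulas in countably many
    variables, over countably many parameters [c], takes one element at a time:
    the partial assignment [b] of the first [k] variables satisfies every
    consequence of [Sigma] that mentions only these variables. As consequences
    are closed under projecting away a variable, saturation extends [b]. *)
Lemma realize_nat (W : Type) (c : W -> M) (Sigma : set (formula L (W + nat))) :
  countable [set: W] ->
  (forall s, (forall f, List.In f s -> Sigma f) ->
     exists v : nat -> M, forall f, List.In f s -> sat (sum_rect _ c v) f) ->
  exists v : nat -> M, forall f, Sigma f -> sat (sum_rect _ c v) f.
Proof.
move=> cW fs.
pose asg (v : nat -> M) := sum_rect (fun=> M) c v : W + nat -> M.
pose supp k (phi : formula L (W + nat)) := forall v v' : nat -> M,
  (forall i, i < k -> v i = v' i) -> sat (asg v) phi = sat (asg v') phi.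
pose inv k b := forall phi, supp k phi -> consequence asg Sigma phi ->
  sat (asg b) phi.
pose upd (b : nat -> M) k d i := if i == k then d else b i.
have step k b : exists d, inv k b -> inv k.+1 (upd b k d).
  have [hinv|] := pselect (inv k b); last by exists (b 0).
  pose A : set M := range (asg b).
  have cA : countable A.
    apply: card_le_trans (card_image_le _ _) _; move: cW.
    by move=> /Pcountable[W' ->]; apply: countableP.
  have pc w : A (c w) by exists (inl w).
  have pb i : A (b i) by exists (inr i).
  pose r (x : W + nat) : option A := match x with
    | inl w => Some (SigSub (mem_set (pc w)))
    | inr i => if i == k then None else Some (SigSub (mem_set (pb i))) end.
  have hr phi d : sat (oapp val d) (rename r phi) = sat (asg (upd b k d)) phi.
    rewrite sat_rename; congr sat; apply: funext => -[w|i] //=.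
    by rewrite /upd; case: eqP.
  have [s hs|d hd] := @saturated_countable A cA
    (rename r @` [set phi | supp k.+1 phi /\ consequence asg Sigma phi]).
    have [ss sE hss] := list_in_image hs.
    pose e (x : W + nat) : option (W + nat) := match x with
      | inl w => Some (inl w)
      | inr i => if i == k then None else Some (inr i) end.
    have he v x : sat (oapp (asg v) x) (rename e (FAnds ss)) =
                  sat (asg (upd v k x)) (FAnds ss).
      rewrite sat_rename; congr sat; apply: funext => -[w|i] //=.
      by rewrite /upd; case: eqP.
    have sex v : sat (asg v) (FEx (rename e (FAnds ss))) <->
        exists x, sat (asg (upd v k x)) (FAnds ss).
      split=> [/sat_FEx[x]|[x hx]]; first by rewrite he; exists x.
      by apply/sat_FEx; exists x; rewrite he.
    have : sat (asg b) (FEx (rename e (FAnds ss))).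
      apply: hinv.
        move=> v v' vv'; apply: propext; rewrite !sex.
        have E x : sat (asg (upd v k x)) (FAnds ss) =
                   sat (asg (upd v' k x)) (FAnds ss).
          apply: propext; split=> /sat_FAnds h; apply/sat_FAnds => f hf.
            rewrite -((hss f hf).1 (upd v k x)); first exact: h.
            by move=> i; rewrite /upd ltnS leq_eqVlt; case: eqP => //= _ /vv'.
          rewrite ((hss f hf).1 _ (upd v' k x)); first exact: h.
          by move=> i; rewrite /upd ltnS leq_eqVlt; case: eqP => //= _ /vv'.
        by split=> -[x hx]; exists x; rewrite ?E // -E.
      have [s0 h0 c0] := consequence_FAnds (fun f hf => (hss f hf).2).
      exists s0 => // v /c0 hv; apply/sex; exists (v k).
      suff -> : upd v k (v k) = v by [].
      by apply: funext => i; rewrite /upd; case: eqP => // ->.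
    move=> /sex[d /sat_FAnds hd]; exists d => f.
    rewrite sE => /List.in_map_iff[g [<- /hd]].
    by rewrite hr.
  exists d => _ phi h1 h2; rewrite -hr; apply: hd; by exists phi.
have [m0] : inhabited M by case: hM => -[].
have /choice[d hd] : forall p : nat * (nat -> M),
  exists x, inv p.1 p.2 -> inv p.1.+1 (upd p.2 p.1 x) by move=> [k b].
pose fix B k := if k is k'.+1 then upd (B k') k' (d (k', B k')) else fun=> m0.
have hB k : inv k (B k).
  elim: k => [|k IH]; last exact: (hd (k, B k)).
  move=> phi hphi [s hs]; have [v hv] := fs s hs.
  by move=> /(_ v hv); rewrite (hphi v (B 0)).
have hBE k i : i < k -> B k i = B i.+1 i.
  elim: k => // k IH; rewrite ltnS leq_eqVlt => /orP[/eqP->//|ik].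
  by rewrite [LHS]/= /upd ltn_eqF // IH.
exists (fun i => B i.+1 i) => f hf.
have [m hm] := sat_support f (sum_rect (fun=> nat) (fun=> 0) id).
have sf : supp m f.
  by move=> v v' vv'; apply: hm => -[w|i] //= /vv'.
have := hB m f sf; rewrite (sf _ (fun i => B i.+1 i)); last exact: hBE.
by apply; exists [:: f] => [g [<-|//]|v]; last by apply; left.
Qed.

End Realize.

Section RealizeCountable.
Variables (L : language) (T : set (sentence L)) (M : structure L).

Lemma transfer_countable (hT : complete_theory T) (M' : structure L) (V : countType)
    (Sigma : set (formula L V)) (v' : V -> M') :
  is_model T M' -> is_model T M -> (forall p, Sigma p -> sat v' p) ->
  forall s, (forall p, List.In p s -> Sigma p) ->
  exists v : V -> M, forall p, List.In p s -> sat v p.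
Proof.
move=> hM' hM hv' s hs; have [[m0] _] := hM'.
have [|v hv] := @transfer _ _ hT M' M (map (rename pickle) s)
  (fun i => oapp v' m0 (unpickle i)) hM' hM.
  move=> p /List.in_map_iff[q [<- hq]]; rewrite sat_rename.
  have -> : (fun i => oapp v' m0 (unpickle i)) \o pickle = v'.
    by apply: funext => x /=; rewrite pickleK.
  exact/hv'/hs.
exists (v \o pickle) => p hp; rewrite -sat_rename.
by apply: hv; apply: List.in_map.
Qed.

Lemma realize_countable (hM : monster T M) (W : Type) (V : countType) (c : W -> M)
    (Sigma : set (formula L (W + V))) :
  countable [set: W] ->
  (forall s, (forall f, List.In f s -> Sigma f) ->
     exists v : V -> M, forall f, List.In f s -> sat (sum_rect _ c v) f) ->
  exists v : V -> M, forall f, Sigma f -> sat (sum_rect _ c v) f.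
Proof.
move=> cW fs; have [[[m0] _] _] := hM.
pose r (x : W + V) : W + nat :=
  match x with inl w => inl w | inr y => inr (pickle y) end.
have hr v f : sat (sum_rect (fun=> M) c v) (rename r f) =
    sat (sum_rect (fun=> M) c (v \o pickle)) f.
  by rewrite sat_rename; congr sat; apply: funext => -[].
have [|v hv] := @realize_nat _ _ _ hM W c (rename r @` Sigma) cW.
  move=> s hs.
  have [s' sE hs'] := list_in_image hs.
  have [v hv] := fs s' hs'.
  exists (fun i => oapp v m0 (unpickle i)) => f.
  rewrite sE => /List.in_map_iff[g [<- /hv]]; rewrite hr.
  by congr sat; apply: funext => -[w|y] //=; rewrite pickleK.
exists (v \o pickle) => f hf; rewrite -hr; apply: hv; by exists f.
Qed.

Lemma realize_closed (hM : monster T M) (V : countType) (Sigma : set (formula L V)) :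
  (forall s, (forall f, List.In f s -> Sigma f) ->
     exists v : V -> M, forall f, List.In f s -> sat v f) ->
  exists v : V -> M, forall f, Sigma f -> sat v f.
Proof.
move=> fs.
have hr v f : sat (sum_rect (fun=> M) (of_void M) v) (rename inr f) = sat v f.
  by rewrite sat_rename; congr sat; apply: funext.
have [||v hv] := @realize_countable hM void V (of_void M) (rename inr @` Sigma).
- exact: countableP.
- move=> s hs.
  have [s' sE hs'] := list_in_image hs.
  have [v hv] := fs s' hs'; exists v => f.
  by rewrite sE => /List.in_map_iff[g [<- /hv]]; rewrite hr.
- by exists v => f hf; rewrite -hr; apply: hv; exists f.
Qed.

End RealizeCountable.

(** * Types of tuples *)

Section Types.
Variable L : language.

Lemma tp_tuple (M : structure L) m (t : m.-tuple M) :
  tp t = Tagged (fun m => set (formula L 'I_m)) [set phi | sat (tnth t) phi].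
Proof.
case: t => s i /=; have e := eqP i; subst m.
by rewrite (bool_irrelevance i (eqxx _)).
Qed.

Lemma tp_mktuple (M : structure L) m (u v : 'I_m -> M) :
  tp (mktuple u) = tp (mktuple v) <-> forall phi, sat u phi <-> sat v phi.
Proof.
have E (w : 'I_m -> M) : tnth (mktuple w) = w.
  by apply: funext => i; rewrite tnth_mktuple.
rewrite !tp_tuple !E; split.
  move=> h phi; have {}h := eq_from_Tagged h.
  have E' : sat u phi = sat v phi := congr1 (fun A : set _ => A phi) h.
  by rewrite E'.
move=> h; congr Tagged; apply: funext => phi; exact: propext (h phi).
Qed.

Lemma size_tp (M : structure L) (s s' : seq M) :
  tp s = tp s' -> size s = size s'.
Proof. by move/(congr1 tag). Qed.

Lemma qftp_tuple (M : structure L) m (t : m.-tuple M) :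
  qftp t = Tagged (fun m => set (formula L 'I_m))
    [set phi | quantifier_free phi /\ sat (tnth t) phi].
Proof.
case: t => s i /=; have e := eqP i; subst m.
by rewrite (bool_irrelevance i (eqxx _)).
Qed.

(** Without function symbols all terms are variables, so the atomic formulas are
    equalities and relations between entries. *)
Lemma qftp_mktuple (no_fun : fun_sym L -> False) (M : structure L) m
    (u v : 'I_m -> M) :
  qftp (mktuple u) = qftp (mktuple v) <->
  (forall i j, u i = u j <-> v i = v j) /\
  (forall r (t : 'I_(rel_arity r) -> 'I_m),
     rel_interp (u \o t) <-> rel_interp (v \o t)).
Proof.
have E (w : 'I_m -> M) : tnth (mktuple w) = w.
  by apply: funext => i; rewrite tnth_mktuple.
rewrite !qftp_tuple !E; split.
  move=> h; have {}h := eq_from_Tagged h.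
  have {}h phi : quantifier_free phi -> sat u phi <-> sat v phi.
    move=> qf; have E' : (quantifier_free phi /\ sat u phi) =
      (quantifier_free phi /\ sat v phi) := congr1 (fun A : set _ => A phi) h.
    split=> hs; first by have : quantifier_free phi /\ sat u phi; [|rewrite E' => -[]].
    by have : quantifier_free phi /\ sat v phi; [|rewrite -E' => -[]].
  split=> [i j|r t].
    exact: (h (FEq (Var L i) (Var L j)) I).
  exact: (h (FRel (fun i => Var L (t i))) I).
move=> [heq hrel]; congr Tagged; apply: funext => phi.
suff h : quantifier_free phi -> sat u phi <-> sat v phi.
  by apply: propext; split=> -[q s]; split=> //; apply/(h q).
have tvar (V : Type) (t : term L V) : exists x, t = Var L x.
  by case: t => [x|f]; [exists x | case: (no_fun f)].
have [W EW] : exists W, W = 'I_m by exists 'I_m.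
move: phi u v heq hrel {E}; rewrite -EW => phi.
elim: phi EW => {W} [V|V t1 t2|V r ts|V p1 IH1 p2 IH2|V p IH] EV u v heq hrel //=.
- have [x ->] := tvar _ t1; have [y ->] := tvar _ t2; by move=> _; apply: heq.
- have /choice[x hx] := fun i => tvar _ (ts i).
  have -> : ts = fun i => Var L (x i) by apply: funext.
  by move=> _; apply: hrel.
- by move=> [/(IH1 EV u v heq hrel) h1 /(IH2 EV u v heq hrel) h2]; rewrite h1 h2.
Qed.

End Types.

(** * Indiscernibles on which a formula defines the edges *)

Lemma same_range_perm (A : Type) k (f g : 'I_k -> A) : injective g ->
  (forall i, exists j, g i = f j) -> exists s : {perm 'I_k}, g = f \o s.
Proof.
move=> gi /choice[s hs].
have si : injective s by move=> i j E; apply: gi; rewrite !hs E.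
by exists (perm si); apply: funext => i /=; rewrite permE.
Qed.

Definition same_pattern (I : Type) k (lt : I -> I -> Prop) (E : ('I_k -> I) -> Prop)
    m (u v : 'I_m -> I) : Prop :=
  (forall i j, lt (u i) (u j) <-> lt (v i) (v j)) /\
  (forall t : 'I_k -> 'I_m, E (u \o t) <-> E (v \o t)).

(** This is why patterns of tuples need not record equalities. *)
Lemma linear_eq (A : Type) (lt : A -> A -> Prop) (u v u' v' : A) :
  strict_linear_order lt -> (lt u v <-> lt u' v') -> (lt v u <-> lt v' u') ->
  u = v -> u' = v'.
Proof.
move=> [irr _ tot] h1 h2 E; subst v.
by case: (tot u' v') => // [/h1|/h2] /irr.
Qed.

Section EdgeFamilies.
Variables (L : language) (T : set (sentence L)) (n p : nat) (q : 'I_n -> nat).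
Variable phi : formula L ('I_p + {j : 'I_n & 'I_(q j)}).

Let Z : finType := ('I_p + {j : 'I_n & 'I_(q j)})%type.

(** The variables [x, y_0, ..., y_(n-1)] of [phi] are numbered from [0] to [n],
    in order to be matched with the vertices of an edge. *)
Definition block_of (z : 'I_p + {j : 'I_n & 'I_(q j)}) : 'I_n.+1 :=
  match z with inl _ => ord0 | inr w => lift ord0 (tag w) end.

(** [X] is enumerated by [pickle], which selects the [y_j] from the sequences
    that are shattered; the [x] belonging to a point is the [b_s] for the set [s]
    of those tuples that form an edge with the point. *)
Lemma IP_family (X : countType) (E : ('I_n.+1 -> X) -> Prop) : has_IP T phi ->
  exists (M' : structure L) (a : X -> Z -> M'), is_model T M' /\
    forall g, sat (fun z => a (g (block_of z)) z) phi <-> E g.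
Proof.
move=> [M' [hM' [a ha]]].
pose tuple_of (x : X) (y : 'I_n -> X) (m : 'I_n.+1) := oapp y x (unlift ord0 m).
have /choice[b hb] := fun x : X => ha [set i | exists2 y, i = pickle \o y & E (tuple_of x y)].
exists M', (fun x z => match z with inl l => b x l
   | inr w => a (tag w) (pickle x) (tagged w) end); split=> // g.
have := hb (g ord0) (fun j => pickle (g (lift ord0 j))) => h.
apply: (iff_trans _ (iff_trans h _)); first by split; congr sat; apply: funext => -[].
have gE : tuple_of (g ord0) (g \o lift ord0) = g.
  by apply: funext => m; rewrite /tuple_of; case: unliftP => [j|] ->.
split=> [[y yE]|hg]; last by exists (g \o lift ord0); rewrite ?gE.
suff -> : y = g \o lift ord0 by rewrite gE.
apply: funext => j; apply: (pcan_inj (@pickleK X)).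
by have := congr1 (@^~ j) yE.
Qed.

Variable M : structure L.
Hypothesis hT : complete_theory T.
Hypothesis hM : monster T M.
Hypothesis hphi : has_IP T phi.

Definition instance (X : Type) (g : 'I_n.+1 -> X) : formula L (X * Z) :=
  rename (fun z => (g (block_of z), z)) phi.

Lemma IP_family_monster (X : countType) (E : ('I_n.+1 -> X) -> Prop) :
  exists a : X -> Z -> M, forall g, sat (fun z => a (g (block_of z)) z) phi <-> E g.
Proof.
have [M' [a' [hM' ha']]] := IP_family E hphi.
pose Sigma : set (formula L (X * Z)) := [set f | exists g,
  (E g /\ f = instance g) \/ (~ E g /\ f = FNot (instance g))].
have inst (N : structure L) (v : X * Z -> N) g : sat v (instance g) =
    sat (fun z => v (g (block_of z), z)) phi by rewrite sat_rename.
have [|v hv] := @realize_closed _ _ _ hM _ Sigma.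
  apply: (transfer_countable hT (M' := M') (v' := fun w => a' w.1 w.2)) => //.
    by case: hM.
  by move=> f [g [[hg ->]|[hg ->]]] /=; rewrite inst; [apply/ha'|move/ha'].
exists (fun x z => v (x, z)) => g; split=> h.
  apply: contrapT => hg; have := hv (FNot (instance g)).
  by move=> /(_ (ex_intro _ g (or_intror (conj hg erefl)))) /=; rewrite inst.
by rewrite -(inst _ v); apply: hv; exists g; left.
Qed.

Section Indiscernible.
Variables (I : countType) (lt : I -> I -> Prop) (E : ('I_n.+1 -> I) -> Prop).
Hypothesis lin : strict_linear_order lt.
Hypothesis symE : symmetric_rel E.
Hypothesis injE : forall g, E g -> injective g.

Inductive constraint :=
| CEdge (g : 'I_n.+1 -> I) of injective g
| CInd m (u v : 'I_m -> I) (psi : formula L ('I_m * Z)) of same_pattern lt E u v.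

Definition at_tuple m (u : 'I_m -> I) (psi : formula L ('I_m * Z)) :
    formula L (I * Z) :=
  rename (fun w => (u w.1, w.2)) psi.

Definition constraint_formula (c : constraint) : formula L (I * Z) :=
  match c with
  | CEdge g _ => if `[<E g>] then instance g else FNot (instance g)
  | CInd _ u v psi _ => FImp (at_tuple u psi) (at_tuple v psi)
  end.

Definition constraint_support (c : constraint) : seq I :=
  match c with
  | CEdge g _ => codom g
  | CInd _ u v _ _ => codom u ++ codom v
  end.

Section FinitePart.
Variable S : seq I.
Let B : finType := seq_sub S.

Definition rank (b : B) : nat := #|[set y : B | `[<lt (val y) (val b)>]]%SET|.

Lemma rank_lt (a b : B) : (rank a < rank b) <-> lt (val a) (val b).
Proof.
have [irr tr tot] := lin.
have half c d : lt (val c) (val d) -> rank c < rank d.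
  move=> cd; apply: proper_card; apply/fintype.properP; split.
    by apply/fintype.subsetP => y; rewrite !inE ?asboolE => yc; apply: tr yc cd.
  by exists c; rewrite !inE ?asboolE //; apply/negP; rewrite ?asboolE; apply: irr.
split; last exact: half.
case: (tot (val a) (val b)) => [//|/val_inj->|/half h h']; first by rewrite ltnn.
by have := ltn_trans h h'; rewrite ltnn.
Qed.

Lemma rank_inj : injective rank.
Proof.
move=> a b ab; have [_ _ tot] := lin.
by case: (tot (val a) (val b)) => [/rank_lt|/val_inj//|/rank_lt]; rewrite ab ltnn.
Qed.

Definition edges : {set {set B}} :=
  [set S | `[<exists g : 'I_n.+1 -> B, E (val \o g) /\ S = g @: [set: 'I_n.+1]>]]%SET.

Lemma card_edges A : A \in edges -> #|A| = n.+1.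
Proof.
rewrite inE ?asboolE => -[g [/injE gi ->]].
rewrite card_imset ?cardsT ?card_ord // => i j ij.
by apply: gi => /=; rewrite ij.
Qed.

Lemma mem_edges (g : 'I_n.+1 -> B) : injective g ->
  (g @: [set: 'I_n.+1]%SET \in edges) <-> E (val \o g).
Proof.
move=> gi; rewrite inE ?asboolE; split; last by exists g.
move=> [g' [g'E Eg]].
have [i|s ->] := @same_range_perm _ _ g' g gi; last exact: symE s g'E.
have : g i \in g @: [set: 'I_n.+1]%SET by apply: imset_f; rewrite inE.
by rewrite Eg => /imsetP[j _ ->]; exists j.
Qed.

Lemma same_pattern_rank m (u v : 'I_m -> B) :
  same_pattern lt E (val \o u) (val \o v) ->
  forall a b, (rank (u a) < rank (u b)) = (rank (v a) < rank (v b)).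
Proof.
move=> [h _] a b; apply/idP/idP => /rank_lt; [move/(h a b).1|move/(h a b).2];
by move/rank_lt.
Qed.

Lemma same_pattern_sym (I' : Type) m k (lt' : I' -> I' -> Prop)
    (E' : ('I_k -> I') -> Prop) (u v : 'I_m -> I') :
  same_pattern lt' E' u v -> same_pattern lt' E' v u.
Proof. by move=> [h1 h2]; split=> *; [rewrite h1|rewrite h2]. Qed.

Lemma same_pattern_edges m (u v : 'I_m -> B) :
  same_pattern lt E (val \o u) (val \o v) ->
  forall Y : {set 'I_m}, (u @: Y \in edges) = (v @: Y \in edges).
Proof.
have half (u' v' : 'I_m -> B) (Y : {set 'I_m}) :
    same_pattern lt E (val \o u') (val \o v') ->
    u' @: Y \in edges -> v' @: Y \in edges.
  move=> [hlt hE]; rewrite !inE ?asboolE => -[g [gE Yg]].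
  have /choice[t ht] : forall i, exists a, a \in Y /\ g i = u' a.
    move=> i; have : g i \in g @: [set: 'I_n.+1]%SET by apply: imset_f; rewrite inE.
    by rewrite -Yg => /imsetP[a aY ->]; exists a.
  exists (v' \o t); split.
    apply/(hE t); move: gE; congr E; apply: funext => i /=.
    by rewrite (ht i).2.
  apply/setP => x; apply/imsetP/imsetP => -[].
    move=> y yY ->; have : u' y \in u' @: Y by apply: imset_f.
    rewrite Yg => /imsetP[i _ ui]; exists i; rewrite ?inE //=.
    apply: val_inj; apply: (linear_eq lin (hlt y (t i)) (hlt (t i) y)) => /=.
    by rewrite ui (ht i).2.
  by move=> i _ ->; exists (t i); rewrite ?(ht i).1.
by move=> uv Y; apply/idP/idP; apply: half => //; apply: same_pattern_sym.
Qed.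

End FinitePart.

(** By compactness finitely many constraints have to be satisfied. A family on
    which [phi] defines the relation of having a common point is indexed by the
    bit sequences. The Ramsey theorem maps the finitely many vertices that are
    involved to bit sequences, such that edges become tuples with a common point
    and the formulas in question only depend on order and edge patterns. *)
Theorem indiscernible_edge_family : exists a : I -> Z -> M,
  (forall g, injective g -> sat (fun z => a (g (block_of z)) z) phi <-> E g) /\
  (forall m (u v : 'I_m -> I), same_pattern lt E u v ->
     forall psi : formula L ('I_m * Z),
     sat (fun w => a (u w.1) w.2) psi <-> sat (fun w => a (v w.1) w.2) psi).
Proof.
have [alpha halpha] := IP_family_monster
  (fun h : 'I_n.+1 -> bitseq => exists i, forall j, nth false (h j) i).
suff [v hv] : exists v : I * Z -> M, forall f,
    (constraint_formula @` setT) f -> sat v f.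
  exists (fun x z => v (x, z)); split.
    move=> g gi.
    have := hv (constraint_formula (CEdge gi)) (ex_intro2 _ _ _ Logic.I erefl) => /=.
    by case: asboolP => hg /=; rewrite sat_rename.
  have half m (u w : 'I_m -> I) psi : same_pattern lt E u w ->
      sat (fun z => v (u z.1, z.2)) psi -> sat (fun z => v (w z.1, z.2)) psi.
    move=> uw; have := hv _ (ex_intro2 _ _ (CInd psi uw) Logic.I erefl) => /=.
    by rewrite !sat_rename.
  by move=> m u w uw psi; split; apply: half => //; apply: same_pattern_sym.
apply: (realize_closed hM) => s /list_in_image[cs -> _].
pose S := flatten (map constraint_support cs).
pose B : finType := seq_sub S.
have memS c x : List.In c cs -> x \in constraint_support c -> x \in S.
  rewrite /S; elim: (cs) => //= d ds IH [->|/IH h] xc; rewrite mem_cat ?xc //.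
  by rewrite h ?orbT.
have lift m (u : 'I_m -> I) : (forall i, u i \in S) ->
    exists u' : 'I_m -> B, u = val \o u'.
  by move=> h; exists (fun i => SeqSub (h i)).
(* For each indiscernibility constraint, the two tuples as tuples of [B]. *)
pose req m := ({uv : ('I_m -> B) * ('I_m -> B) |
   same_pattern lt E (val \o uv.1) (val \o uv.2)} * formula L ('I_m * Z))%type.
pose treated (rs : seq {m : nat & req m}) c := match c with
  | CEdge _ _ => True
  | CInd m u w psi _ => exists (u' w' : 'I_m -> B) h, [/\ u = val \o u',
      w = val \o w' & List.In (existT req m (exist _ (u', w') h, psi)) rs]
  end.
have [rs hrs] : exists rs, forall c, List.In c cs -> treated rs c.
  suff : forall ds, (forall c, List.In c ds -> List.In c cs) ->
      exists rs, forall c, List.In c ds -> treated rs c by apply.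
  elim=> [|d ds IH] hds; first by exists [::].
  have [|rs hrs] := IH; first by move=> c hc; apply: hds; right.
  have dcs : List.In d cs by apply: hds; left.
  case: d dcs {hds} => [g gi|m u w psi uw] dcs.
    by exists rs => c [<-|/hrs].
  have [|u' uE] := lift m u.
    by move=> i; apply: memS dcs _; rewrite mem_cat codom_f.
  have [|w' wE] := lift m w.
    by move=> i; apply: memS dcs _; rewrite mem_cat codom_f orbT.
  have h : same_pattern lt E (val \o u') (val \o w') by rewrite -uE -wE.
  exists (existT req m (exist _ (u', w') h, psi) :: rs) => c [<-|/hrs].
    by exists u', w', h; split=> //; left.
  case: c => //= m1 u1 w1 psi1 s1 [u1' [w1' [h1 [h2 h3 h4]]]].
  by exists u1', w1', h1; split=> //; right.
have r0 : {m : nat & req m}.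
  have no (A : Type) : 'I_0 -> A by case.
  have h : same_pattern lt E (val \o no B) (val \o no B) by split.
  by exists 0; split; [exists (no B, no B)|exact: FFalse].
pose rq i := nth r0 rs i.
have [X [hX hreq]] := @hypergraph_Ramsey B (@rank S) n.+1 (@edges S)
  (@rank_inj S) isT (@card_edges S) (size rs) (fun i => tag (rq i))
  (fun i => (sval (tagged (rq i)).1).1) (fun i => (sval (tagged (rq i)).1).2)
  (fun i h => sat (fun w => alpha (h w.1) w.2) (tagged (rq i)).2)
  (fun i => same_pattern_rank (svalP (tagged (rq i)).1))
  (fun i => same_pattern_edges (svalP (tagged (rq i)).1)).
pose v (x : I * Z) := alpha (oapp X [::] (insub x.1)) x.2.
have vE (b : B) z : v (val b, z) = alpha (X b) z by rewrite /v /= valK.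
exists v => _ /List.in_map_iff[c [<- cin]]; move: (hrs c cin).
case: c cin => [g gi|m u w psi uw] cin.
  move=> _; have [|g' gE] := lift _ g.
    by move=> i; apply: memS cin _; apply: codom_f.
  have g'i : injective g' by move=> i j ij; apply: (gi); rewrite gE /= ij.
  have iff : sat v (instance g) <-> E g.
    rewrite sat_rename.
    have -> : v \o (fun z => (g (block_of z), z)) =
        fun z => alpha ((X \o g') (block_of z)) z.
      by apply: funext => z /=; rewrite gE vE.
    apply: (iff_trans (halpha _)); rewrite gE; apply: (iff_trans _ (mem_edges g'i)).
    apply: (iff_trans _ (hX _ _)); last first.
      by rewrite card_imset // cardsT card_ord.
    split=> -[i hi]; exists i.
      by move=> x /imsetP[j _ ->]; apply: hi.
    by move=> j; apply: hi; apply: imset_f; rewrite inE.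
  by rewrite /=; case: asboolP => /= hg; rewrite iff.
move=> [u' [w' [h [uE wE hin]]]].
have [i [/ltP ilt iE]] := List.In_nth rs _ r0 hin.
have := hreq i; have -> : rq i = existT req m (exist _ (u', w') h, psi).
  by rewrite -iE /rq; elim: (rs) (i) => [|? ? IHr] [|?] //=.
have -> : i < size rs by move: ilt; rewrite -/(size _).
move=> /(_ isT) /= [+ _].
rewrite !sat_rename uE wE; congr (_ -> _); congr sat; apply: funext => -[a z] /=;
by rewrite vE.
Qed.

End Indiscernible.
End EdgeFamilies.

(** * From finite boxes to IP_n *)

(** The assumption is applied to a single relation [D], in which every finite set
    of [n]-tuples is the set of neighbours of a number that codes it. A copy of
    [D] in the model is realised by saturation; its sequences are shattered,
    since a second use of saturation extends the codes of finite sets to all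
    sets. *)
Lemma finite_IP (L : language) (T : set (sentence L)) (M : structure L)
    (hM : monster T M) (n s : nat) (phi : formula L 'I_s) (gam : 'I_s -> 'I_n.+1) :
  (forall N (D : ('I_n.+1 -> nat) -> Prop),
    exists A : 'I_n.+1 -> nat -> 'I_s -> M, forall i, (forall j, i j < N) ->
      sat (fun x => A (gam x) (i (gam x)) x) phi <-> D i) ->
  ~ n_dependent T n.
Proof.
move=> fin nd.
pose code (i : 'I_n -> nat) : seq nat := map i (enum 'I_n).
have code_inj : injective code.
  by move=> i j /eq_in_map E; apply: funext => x; apply: E; rewrite mem_enum.
pose D (i : 'I_n.+1 -> nat) : Prop :=
  code (i \o lift ord0) \in odflt [::] (unpickle (i ord0) : option (seq (seq nat))).
pose V : countType := ('I_n.+1 * nat * 'I_s)%type.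
pose inst (i : 'I_n.+1 -> nat) : formula L V :=
  rename (fun x => (gam x, i (gam x), x)) phi.
pose form i := if `[<D i>] then inst i else FNot (inst i).
have [v hv] : exists v : V -> M, forall f, (form @` setT) f -> sat v f.
  apply: (realize_closed hM) => ss /list_in_image[idx -> _].
  pose N := foldr maxn 0 (map (fun i : 'I_n.+1 -> nat => (\max_j i j).+1) idx).
  have [A hA] := fin N D; exists (fun x => A x.1.1 x.1.2 x.2).
  move=> _ /List.in_map_iff[i [<- iin]].
  have iN j : i j < N.
    rewrite /N; elim: (idx) iin => //= i' idx' IH [->|/IH h].
      by rewrite leq_max ltnS (leq_bigmax j).
    by rewrite leq_max h orbT.
  have hi := hA i iN.
  rewrite /form; case: asboolP => hD /=; rewrite sat_rename; first exact/hi.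
  by move/hi.
pose A j x z := v (j, x, z).
have hA i : sat (fun x => A (gam x) (i (gam x)) x) phi <-> D i.
  have := hv _ (ex_intro2 _ _ i Logic.I erefl).
  by rewrite /form; case: asboolP => hD /=; rewrite sat_rename.
pose q (_ : 'I_n) := s.
pose psi : formula L ('I_s + {j : 'I_n & 'I_(q j)}) := rename (fun x =>
  if unlift ord0 (gam x) is Some j
  then inr (existT (fun j => 'I_(q j)) j x) else inl x) phi.
apply: (nd s q psi); exists M; split; first by case: hM.
exists (fun j i x => A (lift ord0 j) i x) => S.
pose W : countType := ('I_n * nat * 'I_s)%type.
pose c (x : W) := A (lift ord0 x.1.1) x.1.2 x.2.
pose inst' (i : 'I_n -> nat) : formula L (W + 'I_s) := rename (fun x =>
  if unlift ord0 (gam x) is Some j then inl (j, i j, x) else inr x) phi.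
pose form' i := if `[<S i>] then inst' i else FNot (inst' i).
have [b hb] : exists b : 'I_s -> M, forall f, (form' @` setT) f ->
    sat (sum_rect (fun=> M) c b) f.
  apply: (realize_countable hM); first exact: countableP.
  move=> ss /list_in_image[idx -> _].
  pose x0 := pickle (map code (filter (fun i => `[<S i>]) idx)).
  exists (A ord0 x0) => _ /List.in_map_iff[i [<- iin]].
  pose i' (j : 'I_n.+1) := if unlift ord0 j is Some j' then i j' else x0.
  have mem_code i1 : code i1 \in map code (filter (fun i => `[<S i>]) idx) -> S i1.
    elim: (idx) => //= i2 idx' IH; case: asboolP => //= hS.
    by rewrite inE => /orP[/eqP/code_inj->|/IH].
  have Di : D i' <-> S i.
    rewrite /D /i' unlift_none pickleK /=.
    have -> : (fun j => if unlift ord0 j is Some j' then i j' else x0) \o lift ord0 = i.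
      by apply: funext => j /=; rewrite liftK.
    split=> [/mem_code//|hS]; elim: (idx) iin => //= i1 idx' IH [->|/IH h].
      by case: asboolP => // _; rewrite inE eqxx.
    by case: asboolP => // _; rewrite inE h orbT.
  have instE : sat (sum_rect (fun=> M) c (A ord0 x0)) (inst' i) <-> S i.
    rewrite -Di -hA sat_rename; split; congr sat; apply: funext => x /=;
    by rewrite /i'; case: unliftP => [j ->|->]; rewrite ?liftK ?unlift_none.
  by rewrite /form'; case: asboolP => hS /=; rewrite instE.
exists b => i.
have instE : sat (sum_rect (fun=> M) c b) (inst' i) <-> S i.
  have := hb _ (ex_intro2 _ _ i Logic.I erefl).
  by rewrite /form'; case: asboolP => hS /= hf; split=> // /hf.
apply: (iff_trans _ instE); rewrite !sat_rename; split; congr sat;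
by apply: funext => x /=; case: (unlift ord0 (gam x)).
Qed.

(** * Collapse of indiscernibles *)

(** Flattening tuples is a reindexing, which only depends on their lengths. *)
Lemma flatten_reindex (X : Type) (x0 : X) m (len : 'I_m -> nat) :
  exists s (R : 'I_s -> 'I_m) (o : 'I_s -> nat),
  [/\ forall b : 'I_m -> seq X, (forall i, size (b i) = len i) ->
        flatten [seq b i | i <- enum 'I_m] =
        mktuple (fun x : 'I_s => nth x0 (b (R x)) (o x)),
      forall x, o x < len (R x) &
      forall i c, c < len i -> exists2 x, R x = i & o x = c].
Proof.
pose sh := [seq len i | i <- enum 'I_m].
have nth_sh (i : 'I_m) : nth 0 sh i = len i.
  by rewrite (nth_map i) ?size_enum_ord // nth_ord_enum.
have hR (x : 'I_(sumn sh)) : reshape_index sh x < m.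
  by have := reshape_indexP (ltn_ord x); rewrite size_map size_enum_ord.
exists (sumn sh), (fun x => Ordinal (hR x)), (fun x => reshape_offset sh x).
split=> [b hb|x|i c]; last 2 first.
- by rewrite -nth_sh; apply: reshape_offsetP.
- rewrite -nth_sh => hc; exists (Ordinal (flatten_indexP hc)) => /=.
    by apply: val_inj; apply: flatten_indexKl.
  exact: flatten_indexKr.
have shE : shape [seq b i | i <- enum 'I_m] = sh.
  by rewrite /shape -map_comp; apply: eq_map => i /=.
apply: (@eq_from_nth _ x0); first by rewrite size_flatten shE size_tuple.
move=> i; rewrite size_flatten shE => il.
rewrite nth_flatten shE (nth_map (Ordinal (hR (Ordinal il)))); last first.
  by rewrite size_enum_ord; apply: (hR (Ordinal il)).
rewrite -[i in RHS]/(val (Ordinal il)) -tnth_nth tnth_mktuple.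
congr (nth _ (b _) _); apply: val_inj => /=.
by rewrite nth_enum_ord //; apply: (hR (Ordinal il)).
Qed.

(** Ordered hypergraphs with coloured vertices cover both index structures:
    [cl] forces an order between vertices of certain colours, and an edge has an
    admissible sequence of colours. *)
Section ColouredHypergraphs.
Variables (C : Type) (cl : C -> C -> Prop) (k : nat) (adm : ('I_k -> C) -> Prop).

Definition coloured_hypergraph (A : Type) (lt : A -> A -> Prop) (pt : A -> C)
    (E : ('I_k -> A) -> Prop) : Prop :=
  [/\ strict_linear_order lt,
      forall x y, cl (pt x) (pt y) -> lt x y,
      symmetric_rel E,
      forall x, E x -> injective x &
      forall x, E x -> adm (pt \o x)].

Definition universal (I : Type) (lt : I -> I -> Prop) (pt : I -> C)
    (E : ('I_k -> I) -> Prop) : Prop :=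
  forall (A : Type) (lt' : A -> A -> Prop) (pt' : A -> C) (E' : ('I_k -> A) -> Prop),
    finite_set [set: A] -> coloured_hypergraph lt' pt' E' ->
    exists f : A -> I, [/\ forall x y, lt' x y <-> lt (f x) (f y),
      forall x, pt (f x) = pt' x & forall x, E' x <-> E (f \o x)].

Definition same_cut (I : Type) (lt : I -> I -> Prop) (pt : I -> C) m
    (u v : 'I_m -> I) : Prop :=
  (forall i j, lt (u i) (u j) <-> lt (v i) (v j)) /\ forall i, pt (u i) = pt (v i).

End ColouredHypergraphs.

Lemma finite_range_ord (A : Type) m (u : 'I_m -> A) :
  finite_set [set: set_type (range u)].
Proof.
have inU b : range u (u b) by exists b.
have -> : [set: set_type (range u)] = (fun b => SigSub (mem_set (inU b))) @` setT.
  apply/seteqP; split=> // y _; have /set_mem[b _ ub] := valP y.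
  by exists b => //; apply: val_inj.
exact/finite_image/finite_finset.
Qed.

Section Collapse.
Variables (L : language) (T : set (sentence L)) (M : structure L).
Hypothesis hM : monster T M.
Variable n : nat.
Hypothesis hn : 1 <= n.
Hypothesis nd : n_dependent T n.

Variables (C : Type) (cl : C -> C -> Prop) (adm : ('I_n.+1 -> C) -> Prop).
Variables (I : Type) (lt : I -> I -> Prop) (pt : I -> C) (E : ('I_n.+1 -> I) -> Prop).
Hypothesis hI : coloured_hypergraph cl adm lt pt E.
Hypothesis hU : universal cl adm lt pt E.
Variable a : I -> seq M.

Let flat m (u : 'I_m -> I) : seq M := flatten [seq a (u i) | i <- enum 'I_m].

Hypothesis indisc : forall m (u v : 'I_m -> I), same_pattern lt E u v ->
  same_cut lt pt u v -> tp (flat u) = tp (flat v).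

Lemma same_cut_eq m (u v : 'I_m -> I) : same_cut lt pt u v ->
  forall i j, u i = u j <-> v i = v j.
Proof.
have [lin _ _ _ _] := hI.
move=> [h _] i j; split; apply: (linear_eq lin); rewrite h //.
Qed.

Lemma same_cut_sym m (u v : 'I_m -> I) : same_cut lt pt u v -> same_cut lt pt v u.
Proof. by move=> [h1 h2]; split=> *; rewrite ?h1 ?h2. Qed.

Lemma same_cut_comp m (u v : 'I_m -> I) (t t' : 'I_n.+1 -> 'I_m) :
  same_cut lt pt u v -> u \o t = u \o t' -> v \o t = v \o t'.
Proof.
move=> uv Et; apply: funext => j; apply/(same_cut_eq uv).
by have := congr1 (@^~ j) Et.
Qed.

(** As an edge has at least two vertices, two single vertices have the same
    pattern. *)
Lemma size_same_colour x y : pt x = pt y -> size (a x) = size (a y).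
Proof.
have [[irr tr tot] _ _ injE _] := hI.
move=> xy; pose u (_ : 'I_1) := x; pose v (_ : 'I_1) := y.
have noE (w : I) (t : 'I_n.+1 -> 'I_1) : ~ E ((fun=> w) \o t).
  move=> /injE inj; have := inj ord0 (inord 1) erefl => /(congr1 val) /=.
  by rewrite inordK.
have /size_tp : tp (flat u) = tp (flat v).
  apply: indisc; last by split=> // i j; split=> /irr.
  by split=> [i j|t]; [split=> /irr|split=> /noE].
by rewrite /flat !size_flatten /shape !enum_ordSl !enum_ord0 /= !addn0.
Qed.

(** If flipping a single edge changed the type, then blowing up every vertex
    into a large set, with an arbitrary hypergraph on the copies of the flipped
    edge, would shatter arbitrarily large finite boxes. *)
Lemma flip_edge m (u w : 'I_m -> I) (t0 : 'I_n.+1 -> 'I_m) :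
  same_cut lt pt u w -> E (u \o t0) -> ~ E (w \o t0) ->
  (forall t, ~ (exists s : {perm 'I_n.+1}, u \o t = u \o t0 \o s) ->
     E (u \o t) <-> E (w \o t)) ->
  tp (flat u) = tp (flat w).
Proof.
move=> uw Eu nEw Euw; have [lin clI symE injE admE] := hI.
have [irr tr tot] := lin.
have inj0 : injective (u \o t0) := injE _ Eu.
have [[[x0] _] _] := hM.
have [s [R [o [hR _ _]]]] := flatten_reindex x0 (fun i => size (a (u i))).
pose value (u' : 'I_m -> I) (x : 'I_s) := nth x0 (a (u' (R x))) (o x).
have flatE u' : (forall i, pt (u' i) = pt (u i)) -> flat u' = mktuple (value u').
  by move=> h; apply: (hR (fun i => a (u' i))) => i; apply: size_same_colour.
have flatw : flat w = mktuple (value w) by apply: flatE => i; rewrite uw.2.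
have flatu : flat u = mktuple (value u) by apply: flatE.
apply: contrapT => neq.
have [phi [phiu phiw]] : exists phi, sat (value u) phi /\ ~ sat (value w) phi.
  apply: contrapT => no; apply: neq; rewrite flatu flatw.
  apply/tp_mktuple => phi; split=> h; apply: contrapT => h'; apply: no.
    by exists phi.
  by exists (FNot phi); split=> // /(_ h).
(* The number of the copy that is chosen for a vertex when [i j] is chosen for
   the [j]-th vertex of the edge; it is [0] outside the edge. *)
pose lab (i : 'I_n.+1 -> nat) (x : I) : nat :=
  if [pick j | `[<x = u (t0 j)>]] is Some j then i j else 0.
have labE i j : lab i (u (t0 j)) = i j.
  rewrite /lab; case: pickP => [j'|/(_ j)]; rewrite ?asboolE.
    by move=> /inj0 ->.
  by move/asboolPn.
(* The block of variables to which a coordinate belongs. A vertex outside the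
   edge has one copy in use, so its coordinates can be put into any block. *)
pose gam x := odflt ord_max [pick j | `[<u (R x) = u (t0 j)>]].
apply: (@finite_IP _ _ _ hM n s phi gam _ nd) => N D.
pose U := set_type (range u).
pose A := (U * 'I_N.+1)%type.
pose ltA (y z : A) := lt (val y.1) (val z.1) \/ (val y.1 = val z.1 /\ y.2 < z.2).
pose ptA (y : A) := pt (val y.1).
pose base (y : 'I_n.+1 -> A) := fun j => val (y j).1.
(* [D] decides about the copies of the edge, in whichever order its vertices are
   listed; any other tuple of copies is an edge if the tuple it lies over is. *)
pose EA (y : 'I_n.+1 -> A) :=
  (exists p : {perm 'I_n.+1}, base y = u \o t0 \o p /\
     D (fun j => (y (p^-1%g j)).2 : nat)) \/
  (~ (exists p : {perm 'I_n.+1}, base y = u \o t0 \o p) /\ E (base y)).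
have inU b : range u (u b) by exists b.
have finA : finite_set [set: A].
  by rewrite -setXTT; apply: finite_setX; [apply: finite_range_ord|apply: finite_finset].
have EA_base y : EA y -> E (base y).
  by case=> [[p [-> _]]|[]//]; apply: symE.
have classA : coloured_hypergraph cl adm ltA ptA EA.
  split.
  - split.
    + by move=> [y i] [/irr|[_]]; rewrite ?ltnn.
    + move=> [y i] [y' i'] [y'' i''] [h|/= [h1 h1']] [h'|/= [h2 h2']].
      * by left; apply: tr h h'.
      * by left; rewrite /= -h2.
      * by left; rewrite /= h1.
      * by right; split=> /=; [rewrite h1|apply: ltn_trans h1' h2'].
    + move=> [y i] [y' i']; case: (tot (val y) (val y')) => [h|h|h].
      * by constructor 1; left.
      * have {}h := val_inj h; subst y'.
        case: (ltngtP i i') => [ii|ii|/val_inj->]; [constructor 1|constructor 3|constructor 2] => //;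
        by right.
      * by constructor 3; left.
  - by move=> y z /clI; left.
  - move=> y p [[p' [py hD]]|[no hE]].
      left; exists (p * p')%g; split.
        apply: funext => j; have := congr1 (@^~ (p j)) py.
        by rewrite /= permM.
      move: hD; congr D; apply: funext => j /=.
      by rewrite invMg permM permKV.
    right; split; last exact: symE _ p hE.
    move=> [p' py]; apply: no; exists (p^-1 * p')%g; apply: funext => j.
    by have := congr1 (@^~ (p^-1%g j)) py; rewrite /base /= permKV permM.
  - by move=> y /EA_base/injE inj i j ij; apply: inj; rewrite /base ij.
  - by move=> y /EA_base/admE.
have [f [ltf ptf Ef]] := hU finA classA.
pose vtx i b : A := (SigSub (mem_set (inU b)), inord (lab i (u b))).
pose eta i b := f (vtx i b).
exists (fun j x y => value (eta (fun=> x)) y) => i iN.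
have labN x : lab i x < N.+1 by rewrite /lab; case: pickP => // j _; rewrite ltnS ltnW.
have -> : (fun x => value (eta (fun=> i (gam x))) x) = value (eta i).
  apply: funext => x; rewrite /value /eta; congr (nth _ (a (f _)) _).
  rewrite /vtx; congr (_, inord _); rewrite /lab /gam.
  by case: pickP.
have ptE b : pt (eta i b) = pt (u b) by rewrite ptf.
have ltE b c : lt (eta i b) (eta i c) <-> lt (u b) (u c).
  rewrite -ltf; split=> [[//|/= [-> ]]|h]; last by left.
  by rewrite ltnn.
have cutu : same_cut lt pt (eta i) u by [].
have baseE t : base (vtx i \o t) = u \o t by [].
have EE (t : 'I_n.+1 -> 'I_m) : E (eta i \o t) <-> EA (vtx i \o t) by rewrite Ef.
have EA_in (t : 'I_n.+1 -> 'I_m) (p : {perm 'I_n.+1}) : u \o t = u \o t0 \o p ->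
    EA (vtx i \o t) <-> D i.
  move=> tp0.
  have DE : (fun j => (vtx i (t (p^-1%g j))).2 : nat) = i.
    apply: funext => j; have := congr1 (@^~ (p^-1%g j)) tp0.
    by rewrite /= permKV => ->; rewrite inordK ?labE // ltnS ltnW.
  split=> [[[p' [py hD]]|[no _]]|hD].
  - suff p'p : p' = p by move: hD; rewrite p'p /= DE.
    apply/permP => j; apply: inj0; move: py; rewrite baseE tp0 => py.
    by have := congr1 (@^~ j) py.
  - by case: no; exists p; rewrite baseE.
  - by left; exists p; rewrite baseE /= DE.
have EA_out (t : 'I_n.+1 -> 'I_m) : ~ (exists p : {perm 'I_n.+1}, u \o t = u \o t0 \o p) ->
    EA (vtx i \o t) <-> E (u \o t).
  move=> no; split=> [[[p [py _]]|[_]//]|h]; last by right; split; rewrite baseE.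
  by case: no; exists p; rewrite -baseE.
have Ew_in (t : 'I_n.+1 -> 'I_m) (p : {perm 'I_n.+1}) : u \o t = u \o t0 \o p -> ~ E (w \o t).
  move=> /(@same_cut_comp _ u w t (t0 \o p) uw) -> h; apply: nEw.
  have := symE _ p^-1%g h; congr E; apply: funext => j /=; by rewrite permKV.
have [hD|hD] := pselect (D i).
  split=> // _.
  have : tp (flat (eta i)) = tp (flat u).
    apply: indisc => //; split=> [b c|t]; first exact: ltE.
    rewrite EE; have [[p tp0]|no] := pselect (exists p : {perm 'I_n.+1}, u \o t = u \o t0 \o p).
      by rewrite (EA_in t p tp0) tp0; split=> // _; apply: symE.
    exact: EA_out.
  rewrite flatu flatE // => /tp_mktuple h; exact/h.
split=> // h; exfalso; apply: phiw; move: h.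
have : tp (flat (eta i)) = tp (flat w).
  apply: indisc; last by split=> [b c|b]; rewrite ?ltE ?uw.1 // ptE uw.2.
  split=> [b c|t]; first by rewrite ltE uw.1.
  rewrite EE; have [[p tp0]|no] := pselect (exists p : {perm 'I_n.+1}, u \o t = u \o t0 \o p).
    by rewrite (EA_in t p tp0); split=> // /(Ew_in t p tp0).
  by rewrite EA_out // Euw.
by rewrite flatw flatE // => /tp_mktuple h /h.
Qed.

(** Induction on the number of edges in which [u] and [v] differ. The hypergraph
    obtained from [u] by changing one of them occurs in [I], and is one step
    closer to [v]. *)
Theorem same_cut_same_type m (u v : 'I_m -> I) :
  same_cut lt pt u v -> tp (flat u) = tp (flat v).
Proof.
have [lin clI symE injE admE] := hI; have [irr tr tot] := lin.
pose diff (u v : 'I_m -> I) :=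
  [set t : {ffun 'I_n.+1 -> 'I_m} | `[<E (u \o t)>] != `[<E (v \o t)>]]%SET.
have [d] := ubnP #|diff u v|; elim: d u => // d IH u; rewrite ltnS => dd uv.
have [t0|no] := pickP (mem (diff u v)); last first.
  apply: indisc => //; split=> [i j|t]; first exact: uv.1.
  have tE : (finfun t : 'I_n.+1 -> 'I_m) = t by apply: funext => j; rewrite ffunE.
  have := no (finfun t); rewrite /= inE tE => h.
  by apply: asbool_eq_equiv; apply/eqP; apply: negbFE h.
move=> t0d.
pose U := set_type (range u).
have inU b : range u (u b) by exists b.
pose vtx b : U := SigSub (mem_set (inU b)).
(* The hypergraph on the range of [u] in which [u \o t0] is an edge as it is for
   [v]. *)
pose EU (y : 'I_n.+1 -> U) :=
  ((exists p : {perm 'I_n.+1}, val \o y = u \o t0 \o p) /\ E (v \o t0)) \/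
  (~ (exists p : {perm 'I_n.+1}, val \o y = u \o t0 \o p) /\ E (val \o y)).
have Ev_in (t : 'I_n.+1 -> 'I_m) (p : {perm 'I_n.+1}) : u \o t = u \o t0 \o p ->
   E (v \o t) <-> E (v \o t0).
  move=> /(@same_cut_comp _ u v t (t0 \o p) uv) ->; split; last exact: symE.
  move=> h; have := symE _ p^-1%g h; congr E; apply: funext => j /=; by rewrite permKV.
have finU : finite_set [set: U] by apply: finite_range_ord.
have classU : coloured_hypergraph cl adm (fun x y : U => lt (val x) (val y))
    (fun x => pt (val x)) EU.
  split.
  - split; first by move=> x; apply: irr.
    + by move=> x y z; apply: tr.
    + by move=> x y; case: (tot (val x) (val y)) => [h|/val_inj->|h];
        [constructor 1|constructor 2|constructor 3].
  - by move=> x y /clI.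
  - move=> y p [[[p' py] hE]|[no hE]].
      left; split=> //; exists (p * p')%g; apply: funext => j.
      by have := congr1 (@^~ (p j)) py; rewrite /= permM.
    right; split; last exact: symE _ p hE.
    move=> [p' py]; apply: no; exists (p^-1 * p')%g; apply: funext => j.
    by have := congr1 (@^~ (p^-1%g j)) py; rewrite /= permKV permM.
  - move=> y [[[p py] hE] i j ij|[_ /injE inj] i j ij]; last by apply: inj; rewrite /= ij.
    have : (u \o t0 \o p) i = (u \o t0 \o p) j by rewrite -py /= ij.
    by move=> /(same_cut_eq uv)/(injE _ hE)/perm_inj.
  - move=> y [[[p py] hE]|[_ /admE]//].
    have := admE _ (symE _ p hE); congr adm; apply: funext => j /=.
    by have := congr1 (@^~ j) py => /= ->; rewrite uv.2.
have [f [ltf ptf Ef]] := hU finU classU.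
pose w b := f (vtx b).
have uw : same_cut lt pt u w.
  by split=> [b c|b]; [rewrite -ltf|rewrite ptf].
have wv : same_cut lt pt w v.
  by split=> [b c|b]; [rewrite -uw.1 uv.1|rewrite -uw.2 uv.2].
have Ew_in (t : 'I_n.+1 -> 'I_m) (p : {perm 'I_n.+1}) : u \o t = u \o t0 \o p ->
   E (w \o t) <-> E (v \o t0).
  move=> tp0; rewrite -(Ef (vtx \o t)); split=> [[[_]//|[no]]|h].
    by case: no; exists p.
  by left; split=> //; exists p.
have Ew_out (t : 'I_n.+1 -> 'I_m) : ~ (exists p : {perm 'I_n.+1}, u \o t = u \o t0 \o p) ->
    E (w \o t) <-> E (u \o t).
  move=> no; rewrite -(Ef (vtx \o t)); split=> [[[]//|[]//]|h]; by right.
have id0 : u \o t0 = u \o t0 \o (1 : {perm 'I_n.+1})%g.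
  by apply: funext => j /=; rewrite perm1.
have tuw : tp (flat u) = tp (flat w).
  have [Eu|nEu] := pselect (E (u \o t0)).
    apply: (@flip_edge _ u w t0) => //.
      move=> /(Ew_in t0 _ id0) Ev; move: t0d; rewrite !inE.
      by rewrite !asboolT ?eqxx.
    by move=> t no; rewrite Ew_out.
  have Ev : E (v \o t0).
    apply: contrapT => nEv; move: t0d; rewrite !inE.
    by rewrite !asboolF ?eqxx.
  apply/esym; apply: (@flip_edge _ w u t0) => //.
  - exact: same_cut_sym.
  - exact/(Ew_in t0 _ id0).
  - move=> t no; apply: Ew_out => -[p tp0]; apply: no; exists p.
    exact: (@same_cut_comp _ u w t (t0 \o p) uw).
rewrite tuw; apply: IH => //.
apply: leq_trans dd; apply: proper_card; apply/fintype.properP; split; last first.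
  exists t0 => //; rewrite !inE negbK; apply/eqP/asbool_equiv_eq.
  by rewrite (Ew_in t0 _ id0).
apply/fintype.subsetP => t; rewrite !inE; apply: contra => h.
have {}h : E (u \o t) <-> E (v \o t) by apply: asbool_eq_equiv; apply/eqP.
apply/eqP/asbool_equiv_eq.
have [[p tp0]|no] := pselect (exists p : {perm 'I_n.+1}, u \o t = u \o t0 \o p).
  by rewrite (Ew_in t p tp0) (Ev_in t p tp0).
by rewrite Ew_out.
Qed.

End Collapse.

(** * Indiscernibles that do not collapse *)

Section Expansion.
Variables (L : language) (T : set (sentence L)) (M : structure L).
Hypothesis hT : complete_theory T.
Hypothesis hM : monster T M.
Variable n : nat.

Lemma indiscernible_edge_family_countable (I : Type) (lt : I -> I -> Prop)
    (E : ('I_n.+1 -> I) -> Prop) p (q : 'I_n -> nat)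
    (phi : formula L ('I_p + {j : 'I_n & 'I_(q j)})) :
  countable [set: I] -> strict_linear_order lt -> symmetric_rel E ->
  (forall g, E g -> injective g) -> has_IP T phi ->
  exists a : I -> 'I_p + {j : 'I_n & 'I_(q j)} -> M,
  (forall g, injective g -> sat (fun z => a (g (block_of z)) z) phi <-> E g) /\
  (forall m (u v : 'I_m -> I), same_pattern lt E u v ->
     forall psi : formula L ('I_m * ('I_p + {j : 'I_n & 'I_(q j)})),
     sat (fun w => a (u w.1) w.2) psi <-> sat (fun w => a (v w.1) w.2) psi).
Proof.
move=> cI lin symE injE hphi; have [I' EI] := Pcountable cI.
by subst I; exact: (indiscernible_edge_family hT hM hphi lin symE injE).
Qed.

Variables (C : Type) (cl : C -> C -> Prop) (adm : ('I_n.+1 -> C) -> Prop).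
Variables (I : Type) (lt : I -> I -> Prop) (pt : I -> C) (E : ('I_n.+1 -> I) -> Prop).
Hypothesis hI : coloured_hypergraph cl adm lt pt E.
Hypothesis hU : universal cl adm lt pt E.
Hypothesis cI : countable [set: I].

(** A colouring of the vertices for which the complete and the empty hypergraph
    on ['I_n.+1] are both allowed. *)
Variable c0 : 'I_n.+1 -> C.
Hypothesis c0_lt : forall i j : 'I_n.+1, cl (c0 i) (c0 j) -> i < j.
Hypothesis c0_adm : forall x : 'I_n.+1 -> 'I_n.+1, injective x -> adm (c0 \o x).

Lemma edge_and_nonedge : exists g g' : 'I_n.+1 -> I,
  [/\ same_cut lt pt g g', injective g, injective g', E g & ~ E g'].
Proof.
have [lin _ _ _ _] := hI; have [irr _ _] := lin.
have lin0 : strict_linear_order (fun i j : 'I_n.+1 => i < j).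
  split; first by move=> i; rewrite ltnn.
    by move=> i j l; apply: ltn_trans.
  by move=> i j; case: (ltngtP i j) => [h|h|/val_inj->];
    [constructor 1|constructor 3|constructor 2].
have fin0 : finite_set [set: 'I_n.+1] by apply: finite_finset.
have inj_lt (f : 'I_n.+1 -> I) : (forall i j : 'I_n.+1, i < j <-> lt (f i) (f j)) -> injective f.
  move=> h i j ij; apply: val_inj; apply/eqP.
  by case: ltngtP => // /h; rewrite ij => /irr.
have [|g [g1 g2 g3]] := hU (lt' := fun i j : 'I_n.+1 => i < j) (pt' := c0)
    (E' := fun x => injective x) fin0.
  split=> //; first by move=> x s h; apply: inj_comp => //; apply: perm_inj.
have [|g' [g1' g2' g3']] := hU (lt' := fun i j : 'I_n.+1 => i < j) (pt' := c0)
    (E' := fun _ => False) fin0.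
  by split.
exists g, g'; split.
- by split=> [i j|i]; rewrite -?g1 -?g1' ?g2 ?g2'.
- exact: inj_lt.
- exact: inj_lt.
- exact/(g3 id).
- by move/(g3' id).
Qed.

(** A family on which a formula with IP_n defines the edges, and that is
    indiscernible with respect to order and edges, would give the same type to
    an edge and to a non-edge. *)
Lemma collapse_n_dependent :
  (forall a : I -> seq M,
    (forall m (u v : 'I_m -> I), same_pattern lt E u v -> same_cut lt pt u v ->
       tp (flatten [seq a (u i) | i <- enum 'I_m]) =
       tp (flatten [seq a (v i) | i <- enum 'I_m])) ->
    forall m (u v : 'I_m -> I), same_cut lt pt u v ->
       tp (flatten [seq a (u i) | i <- enum 'I_m]) =
       tp (flatten [seq a (v i) | i <- enum 'I_m])) ->
  n_dependent T n.
Proof.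
move=> coll p q phi hphi.
have [lin _ symE injE _] := hI.
have [a [aE aI]] := indiscernible_edge_family_countable cI lin symE injE hphi.
pose Z : finType := ('I_p + {j : 'I_n & 'I_(q j)})%type.
pose a' x := [seq a x z | z <- enum Z].
have [[[x0] _] _] := hM.
have sa' x : size (a' x) = #|Z| by rewrite size_map cardE.
have nth_a' x z : nth x0 (a' x) (enum_rank z) = a x z.
  by rewrite (nth_map z) -?cardE // nth_enum_rank.
have [g [g' [cut gi g'i Eg nEg']]] := edge_and_nonedge.
have : tp (flatten [seq a' (g i) | i <- enum 'I_n.+1]) =
       tp (flatten [seq a' (g' i) | i <- enum 'I_n.+1]).
  apply: coll cut => m u v uv _.
  have [s [R [o [hR oR _]]]] := flatten_reindex x0 (fun _ : 'I_m => #|Z|).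
  rewrite !(hR (fun i => a' _)) //; apply/tp_mktuple => psi.
  have E' (w : 'I_m -> I) : (fun x : 'I_s => nth x0 (a' (w (R x))) (o x)) =
      (fun y => a (w y.1) y.2) \o (fun x => (R x, enum_val (Ordinal (oR x)))).
    by apply: funext => x /=; rewrite -nth_a' enum_valK.
  by rewrite !E' -!sat_rename; apply: aI.
have [s [R [o [hR _ oR]]]] := flatten_reindex x0 (fun _ : 'I_n.+1 => #|Z|).
rewrite !(hR (fun i => a' _)) // => /tp_mktuple h.
have /choice[kap hk] : forall z : Z, exists x, R x = block_of z /\ o x = enum_rank z.
  by move=> z; have [x] := oR (block_of z) _ (ltn_ord (enum_rank z)); exists x.
have E' (w : 'I_n.+1 -> I) : (fun x : 'I_s => nth x0 (a' (w (R x))) (o x)) \o kap =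
    fun z => a (w (block_of z)) z.
  by apply: funext => z /=; rewrite (hk z).1 (hk z).2 nth_a'.
move: (h (rename kap phi)); rewrite !sat_rename !E' !aE // => -[h1 _].
exact/nEg'/h1.
Qed.

End Expansion.

Lemma seqs_mktuple (X : Type) (s s' : seq X) : size s = size s' ->
  exists m (u v : 'I_m -> X), s = mktuple u /\ s' = mktuple v.
Proof.
have E m (t : m.-tuple X) : t = mktuple (tnth t).
  by apply: eq_from_tnth => i; rewrite tnth_mktuple.
move=> /esym/eqP ss'; exists (size s), (tnth (in_tuple s)), (tnth (Tuple ss')).
by rewrite -!E.
Qed.

(** The condition on lengths is subsumed, since tuples of the same type have the
    same length. *)
Lemma indiscernibleP (L0 L : language) (I : structure L0) (M : structure L)
    (a : I -> seq M) (Q : forall m, ('I_m -> I) -> ('I_m -> I) -> Prop) :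
  (forall m (u v : 'I_m -> I), qftp (mktuple u) = qftp (mktuple v) <-> Q m u v) ->
  indiscernible a <-> forall m (u v : 'I_m -> I), Q m u v ->
     tp (flatten [seq a (u i) | i <- enum 'I_m]) =
     tp (flatten [seq a (v i) | i <- enum 'I_m]).
Proof.
move=> hQ.
have E m (u : 'I_m -> I) : flatten (map a (mktuple u)) =
    flatten [seq a (u i) | i <- enum 'I_m].
  by rewrite /= -map_comp.
split=> [[_ h] m u v /hQ uv|h].
  by rewrite -!E; apply: h; rewrite ?size_tuple.
suff h2 u v : size u = size v -> qftp u = qftp v ->
    tp (flatten (map a u)) = tp (flatten (map a v)).
  split=> // i j ij; have := h2 [:: i] [:: j] erefl ij.
  by rewrite /= !cats0 => /size_tp.
by move=> /seqs_mktuple[m [u' [v' [-> ->]]]] /hQ uv; rewrite !E; apply: h.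
Qed.

(** * The random ordered hypergraph *)

Lemma pair_tuple (A : Type) (x : 'I_2 -> A) : x = tnth [tuple x ord0; x ord_max].
Proof.
apply: funext => i; case: (unliftP ord0 i) => [j|] -> //.
by rewrite (ord1 j); congr x; apply: val_inj.
Qed.

Lemma single_tuple (A : Type) (x : 'I_1 -> A) : x = tnth [tuple x ord0].
Proof. by apply: funext => i; rewrite (ord1 i). Qed.

Lemma comp_pair (A B : Type) (f : A -> B) x y :
  f \o tnth [tuple x; y] = tnth [tuple f x; f y].
Proof. by rewrite [LHS]pair_tuple. Qed.

Lemma comp_single (A B : Type) (f : A -> B) x :
  f \o tnth [tuple x] = tnth [tuple f x].
Proof. by rewrite [LHS]single_tuple. Qed.

Lemma lift_range (A : Type) m (u : 'I_m -> A) :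
  exists u' : 'I_m -> set_type (range u), u = val \o u'.
Proof.
have inU b : range u (u b) by exists b.
by exists (fun b => SigSub (mem_set (inU b))).
Qed.

(** The axioms of linear orders involve at most three points, so they can be
    checked in finite substructures. *)
Lemma finite_set3 (A : Type) (x y z : A) : exists S : set A,
  finite_set [set: S] /\ exists x' y' z' : S, [/\ val x' = x, val y' = y & val z' = z].
Proof.
pose u := tnth [tuple x; y; z].
exists (range u); split; first exact: finite_range_ord.
have inU b : range u (u b) by exists b.
exists (SigSub (mem_set (inU ord0))), (SigSub (mem_set (inU (inord 1)))),
  (SigSub (mem_set (inU ord_max))); split=> //=.
by rewrite /u (tnth_nth x) /= inordK.
Qed.

Section Hypergraph.
Variables (n : nat) (G : structure (L_hypergraph n.+1)).
Hypothesis hG : is_random_hypergraph G.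

Definition hypergraph_structure (A : Type) (lt : A -> A -> Prop)
    (E : ('I_n.+1 -> A) -> Prop) : structure (L_hypergraph n.+1) :=
  @Structure (L_hypergraph n.+1) A (fun f => match f with end)
    (fun r => match r with HLt => fun x => lt (x ord0) (x ord_max) | HEdge => E end).

Lemma hypergraph_embedding A (lt : A -> A -> Prop) E
    (f : hypergraph_structure lt E -> G) :
  embedding f <-> [/\ injective f, forall x y, lt x y <-> hlt (f x) (f y) &
    forall x, E x <-> hedge (f \o x)].
Proof.
split=> [[fi _ h]|[fi hlt hE]].
  split=> // [x y|x]; last exact: (h HEdge x).
  have := h HLt (tnth [tuple x; y]).
  by rewrite comp_pair.
split=> //; first by case.
case=> /= x; last exact: hE.
apply: (iff_trans (hlt _ _)); rewrite /Defs.hlt.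
by rewrite -(pair_tuple (f \o x)).
Qed.

Lemma hypergraph_sub (S : set G) : finite_set [set: S] ->
  ordered_hypergraph (hypergraph_structure (fun x y : S => hlt (val x) (val y))
    (fun x => hedge (val \o x))).
Proof.
move=> fS; have [_ age _] := hG.
set A := hypergraph_structure _ _.
suff /age[_ //] : finite_set [set: A] /\ exists f : A -> G, embedding f.
split=> //; exists val; apply/hypergraph_embedding; split=> //; exact: val_inj.
Qed.

Definition no_colour (x : G) := tt.

Lemma hypergraph_class : coloured_hypergraph (fun _ _ : unit => False)
  (fun _ : 'I_n.+1 -> unit => True) (@hlt _ G) no_colour (@hedge _ G).
Proof.
split=> //.
- split.
  + move=> x; have [S [fS [x' [_ [_ [<- _ _]]]]]] := finite_set3 x x x.
    by have [[irr _ _] _ _] := hypergraph_sub fS; apply: irr.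
  + move=> x y z; have [S [fS [x' [y' [z' [<- <- <-]]]]]] := finite_set3 x y z.
    by have [[_ tr _] _ _] := hypergraph_sub fS; apply: tr.
  + move=> x y; have [S [fS [x' [y' [_ [<- <- _]]]]]] := finite_set3 x y y.
    have [[_ _ tot] _ _] := hypergraph_sub fS.
    by case: (tot x' y') => h; [constructor 1|constructor 2; rewrite h|constructor 3].
- move=> x s; have [x' {1 2}->] := lift_range x.
  have [_ sym _] := hypergraph_sub (finite_range_ord x); exact: (sym x' s).
- move=> x; have [x' xE] := lift_range x; move=> hx i j ij.
  have [_ _ inj] := hypergraph_sub (finite_range_ord x).
  have : injective x' by apply: inj; rewrite /hedge /= -xE.
  have e b : val (x' b) = x b by rewrite -[LHS]/((val \o x') b) -xE.
  by apply; apply: val_inj; rewrite !e.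
Qed.

Lemma hypergraph_universal : universal (fun _ _ : unit => False)
  (fun _ : 'I_n.+1 -> unit => True) (@hlt _ G) no_colour (@hedge _ G).
Proof.
move=> A lt pt E fA [lin _ symE injE _]; have [_ age _] := hG.
have /age[_ [f]] : finite_set [set: hypergraph_structure lt E] /\
    ordered_hypergraph (hypergraph_structure lt E) by split.
move=> /hypergraph_embedding[_ h1 h2]; exists f; split=> // x.
by rewrite /no_colour; case: (pt x).
Qed.

Lemma hypergraph_indiscernible (L : language) (M : structure L) (a : G -> seq M) :
  indiscernible a <-> forall m (u v : 'I_m -> G),
    same_pattern (@hlt _ G) (@hedge _ G) u v /\ same_cut (@hlt _ G) no_colour u v ->
    tp (flatten [seq a (u i) | i <- enum 'I_m]) =
    tp (flatten [seq a (v i) | i <- enum 'I_m]).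
Proof.
have [lin _ _ _ _] := hypergraph_class.
apply: indiscernibleP => m u v.
rewrite qftp_mktuple; last by case.
split.
  move=> [_ h]; have hl i j : hlt (u i) (u j) <-> hlt (v i) (v j).
    by have := h HLt (tnth [tuple i; j]); rewrite !comp_pair.
  split; first by split=> [//|t]; apply: (h HEdge t).
  by split.
move=> [[hl hE] _]; split.
  by move=> i j; split; apply: (linear_eq lin); rewrite hl.
case=> t; last exact: hE.
rewrite (pair_tuple (u \o t)) (pair_tuple (v \o t)); exact: hl.
Qed.

Lemma hypergraph_order_indiscernible (L : language) (M : structure L) (a : G -> seq M) :
  order_indiscernible a <-> forall m (u v : 'I_m -> G),
    same_cut (@hlt _ G) no_colour u v ->
    tp (flatten [seq a (u i) | i <- enum 'I_m]) =
    tp (flatten [seq a (v i) | i <- enum 'I_m]).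
Proof.
have [lin _ _ _ _] := hypergraph_class.
apply: indiscernibleP => m u v.
rewrite qftp_mktuple; last by case=> -[].
have inlt : [set HLt] HLt by [].
split.
  move=> [_ h]; split=> // i j.
  by have := h (SigSub (mem_set inlt)) (tnth [tuple i; j]); rewrite !comp_pair.
move=> [hl _]; split.
  by move=> i j; split; apply: (linear_eq lin); rewrite hl.
case=> r hr; have rE : r = HLt by apply: set_mem hr.
subst r => t; rewrite /rel_interp /=.
rewrite (pair_tuple (u \o t)) (pair_tuple (v \o t)); exact: hl.
Qed.

End Hypergraph.

(** * The random ordered partite hypergraph *)

Section Partite.
Variables (n : nat) (G : structure (L_partite n.+1)).
Hypothesis hG : is_random_partite_hypergraph G.

Definition partite_structure (A : Type) (lt : A -> A -> Prop)
    (P : 'I_n.+1 -> A -> Prop) (E : ('I_n.+1 -> A) -> Prop) :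
    structure (L_partite n.+1) :=
  @Structure (L_partite n.+1) A (fun f => match f with end)
    (fun r => match r with PLt => fun x => lt (x ord0) (x ord_max) | PEdge => E
       | PPart i => fun x => P i (x ord0) end).

Lemma partite_embedding A (lt : A -> A -> Prop) P E
    (f : partite_structure lt P E -> G) :
  embedding f <-> [/\ injective f, forall x y, lt x y <-> plt (f x) (f y),
    forall i x, P i x <-> part i (f x) & forall x, E x <-> pedge (f \o x)].
Proof.
split=> [[fi _ h]|[fi hlt hP hE]].
  split=> // [x y|i x|x]; last exact: (h PEdge x).
    by have := h PLt (tnth [tuple x; y]); rewrite comp_pair.
  by have := h (PPart i) (tnth [tuple x]); rewrite comp_single.
split=> //; first by case.
case=> [||i] /= x; last 1 first.
- apply: (iff_trans (hP _ _)); rewrite /part.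
  by rewrite -(single_tuple (f \o x)).
- apply: (iff_trans (hlt _ _)); rewrite /plt.
  by rewrite -(pair_tuple (f \o x)).
- exact: hE.
Qed.

Lemma partite_sub (S : set G) : finite_set [set: S] ->
  ordered_partite_hypergraph (partite_structure (fun x y : S => plt (val x) (val y))
    (fun i x => part i (val x)) (fun x => pedge (val \o x))).
Proof.
move=> fS; have [_ age _] := hG.
set A := partite_structure _ _ _.
suff /age[_ //] : finite_set [set: A] /\ exists f : A -> G, embedding f.
split=> //; exists val; apply/partite_embedding; split=> //; exact: val_inj.
Qed.

Lemma part_unique (x : G) : exists i : 'I_n.+1, forall j, part j x <-> j = i.
Proof.
have [S [fS [x' [_ [_ [<- _ _]]]]]] := finite_set3 x x x.
have [/(_ x')[i [hi ui]] _ _ _ _] := partite_sub fS.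
by exists i => j; split=> [/ui//|->].
Qed.

Definition colour (x : G) : 'I_n.+1 := sval (cid (part_unique x)).

Lemma colourP (x : G) j : part j x <-> j = colour x.
Proof. exact: (svalP (cid (part_unique x))). Qed.

Lemma injective_surjective k (f : 'I_k -> 'I_k) : injective f ->
  forall i, exists j, f j = i.
Proof. by move=> fi i; exists ((perm fi)^-1%g i); have := permE fi ((perm fi)^-1%g i); rewrite permKV. Qed.

(** An edge of a partite hypergraph meets every part, which makes the colours of
    its vertices distinct. *)
Lemma surjective_injective k (f : 'I_k -> 'I_k) :
  (forall i, exists j, f j = i) -> injective f.
Proof.
move=> /choice[h fh]; have hi : injective h by apply: can_inj fh.
move=> j j'; have [i <-] := injective_surjective hi j.
by have [i' <-] := injective_surjective hi j'; rewrite !fh => ->.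
Qed.

Lemma partite_class : coloured_hypergraph (fun i j : 'I_n.+1 => i < j)
  (fun c : 'I_n.+1 -> 'I_n.+1 => injective c) (@plt _ G) colour (@pedge _ G).
Proof.
have adm x : pedge x -> injective (colour \o x).
  move=> hx; have [x' xE] := lift_range x.
  have [_ _ _ _ h] := partite_sub (finite_range_ord x).
  apply: surjective_injective => i.
  have hx' : pedge (val \o x') by rewrite -xE.
  have [y [[[j jy] /colourP ->] _]] := h x' hx' i; exists j.
  by rewrite -jy /= -[val (x' j)]/((val \o x') j) -xE.
split=> //.
- split.
  + move=> x; have [S [fS [x' [_ [_ [<- _ _]]]]]] := finite_set3 x x x.
    by have [_ [irr _ _] _ _ _] := partite_sub fS; apply: irr.
  + move=> x y z; have [S [fS [x' [y' [z' [<- <- <-]]]]]] := finite_set3 x y z.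
    by have [_ [_ tr _] _ _ _] := partite_sub fS; apply: tr.
  + move=> x y; have [S [fS [x' [y' [_ [<- <- _]]]]]] := finite_set3 x y y.
    have [_ [_ _ tot] _ _ _] := partite_sub fS.
    by case: (tot x' y') => h; [constructor 1|constructor 2; rewrite h|constructor 3].
- move=> x y; have [S [fS [x' [y' [_ [<- <- _]]]]]] := finite_set3 x y y.
  have [_ _ h _ _] := partite_sub fS; move=> cxy.
  by apply: (h _ _ x' y' cxy); apply/colourP.
- move=> x s; have [x' {1 2}->] := lift_range x.
  have [_ _ _ sym _] := partite_sub (finite_range_ord x); exact: (sym x' s).
- by move=> x /adm h i j ij; apply: h; rewrite /= ij.
Qed.

Lemma partite_universal : universal (fun i j : 'I_n.+1 => i < j)
  (fun c : 'I_n.+1 -> 'I_n.+1 => injective c) (@plt _ G) colour (@pedge _ G).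
Proof.
move=> A lt pt E fA [lin clI symE injE admE]; have [_ age _] := hG.
pose A' := partite_structure lt (fun i x => i = pt x) E.
have /age[_ [f]] : finite_set [set: A'] /\ ordered_partite_hypergraph A'.
  split=> //; split=> //.
  - by move=> x; exists (pt x); split=> // j ->.
  - by move=> i j x y ij hx hy; apply: clI; rewrite -hx -hy.
  - move=> x hx i; have [j ji] := injective_surjective (admE _ hx) i.
    exists (x j); split; first by split; [exists j|exact: esym ji].
    move=> y [[j' <-] iE]; congr x; apply: (admE _ hx).
    by rewrite ji iE.
move=> /partite_embedding[_ h1 h2 h3]; exists f; split=> // x.
by apply/esym/colourP/h2.
Qed.

Lemma partite_indiscernible (L : language) (M : structure L) (a : G -> seq M) :
  indiscernible a <-> forall m (u v : 'I_m -> G),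
    same_pattern (@plt _ G) (@pedge _ G) u v /\ same_cut (@plt _ G) colour u v ->
    tp (flatten [seq a (u i) | i <- enum 'I_m]) =
    tp (flatten [seq a (v i) | i <- enum 'I_m]).
Proof.
have [lin _ _ _ _] := partite_class.
apply: indiscernibleP => m u v.
rewrite qftp_mktuple; last by case.
split.
  move=> [_ h]; have hl i j : plt (u i) (u j) <-> plt (v i) (v j).
    by have := h PLt (tnth [tuple i; j]); rewrite !comp_pair.
  split; first by split=> [//|t]; apply: (h PEdge t).
  split=> // i; have := h (PPart (colour (u i))) (tnth [tuple i]).
  by rewrite !comp_single => -[h1 _]; apply/colourP/h1/colourP.
move=> [[hl hE] [_ hc]]; split.
  by move=> i j; split; apply: (linear_eq lin); rewrite hl.
case=> [||i] t; last 1 first.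
- rewrite (single_tuple (u \o t)) (single_tuple (v \o t)).
  by apply: (iff_trans (colourP _ _)); rewrite /= hc; apply: iff_sym; apply: colourP.
- rewrite (pair_tuple (u \o t)) (pair_tuple (v \o t)); exact: hl.
- exact: hE.
Qed.

Lemma partite_op_indiscernible (L : language) (M : structure L) (a : G -> seq M) :
  op_indiscernible a <-> forall m (u v : 'I_m -> G),
    same_cut (@plt _ G) colour u v ->
    tp (flatten [seq a (u i) | i <- enum 'I_m]) =
    tp (flatten [seq a (v i) | i <- enum 'I_m]).
Proof.
have [lin _ _ _ _] := partite_class.
apply: indiscernibleP => m u v.
rewrite qftp_mktuple; last by case=> -[].
set Rop := [set PLt] `|` range (@PPart n.+1).
have inlt : Rop PLt by left.
have inpart i : Rop (PPart i) by right; exists i.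
split.
  move=> [_ h]; split=> [i j|i].
    by have := h (SigSub (mem_set inlt)) (tnth [tuple i; j]); rewrite !comp_pair.
  have := h (SigSub (mem_set (inpart (colour (u i))))) (tnth [tuple i]).
  by rewrite !comp_single => -[h1 _]; apply/colourP/h1/colourP.
move=> [hl hc]; split.
  by move=> i j; split; apply: (linear_eq lin); rewrite hl.
case=> r hr; have : Rop r by apply: set_mem hr.
case=> [/= rE|[i _ rE]]; subst r => t; rewrite /rel_interp /=.
  rewrite (pair_tuple (u \o t)) (pair_tuple (v \o t)); exact: hl.
rewrite (single_tuple (u \o t)) (single_tuple (v \o t)).
by apply: (iff_trans (colourP _ _)); rewrite /= hc; apply: iff_sym; apply: colourP.
Qed.

End Partite.

Theorem theorem5p4 (n : nat) (hn : 1 <= n)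
    (L : language) (T : set (sentence L)) (hT : complete_theory T)
    (M : structure L) (hM : monster T M)
    (G : structure (L_hypergraph n.+1)) (hG : is_random_hypergraph G)
    (Gp : structure (L_partite n.+1)) (hGp : is_random_partite_hypergraph Gp) :
  [<-> n_dependent T n;
       forall a : Gp -> seq M, indiscernible a -> op_indiscernible a;
       forall a : G -> seq M, indiscernible a -> order_indiscernible a].
Proof.
have cG : countable [set: G] by case: hG.
have cGp : countable [set: Gp] by case: hGp.
have partite_collapse : n_dependent T n ->
    forall a : Gp -> seq M, indiscernible a -> op_indiscernible a.
  move=> nd a /(partite_indiscernible hGp) ind.
  apply/(partite_op_indiscernible hGp).
  apply: (same_cut_same_type hM hn nd (partite_class hGp) (partite_universal hGp)).
  by move=> m u v uv cut; apply: ind.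
have collapse : n_dependent T n ->
    forall a : G -> seq M, indiscernible a -> order_indiscernible a.
  move=> nd a /(hypergraph_indiscernible hG) ind.
  apply/(hypergraph_order_indiscernible hG).
  apply: (same_cut_same_type hM hn nd (hypergraph_class hG) (hypergraph_universal hG)).
  by move=> m u v uv cut; apply: ind.
tfae=> //.
- move=> h; apply: collapse.
  apply: (collapse_n_dependent hT hM (partite_class hGp) (partite_universal hGp) cGp
    (c0 := id)) => // a ind.
  apply/(partite_op_indiscernible hGp)/h/(partite_indiscernible hGp) => m u v [].
  exact: ind.
- move=> h.
  apply: (collapse_n_dependent hT hM (hypergraph_class hG) (hypergraph_universal hG) cG
    (c0 := fun=> tt)) => // a ind.
  apply/(hypergraph_order_indiscernible hG)/h/(hypergraph_indiscernible hG) => m u v [].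
  exact: ind.
Qed.
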